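(* Let $p$ be a fixed prime and $\mathbb{F}=\mathbb{F}_p$. For any $\delta>0$, there exists a constant $c(\delta)>0$ such that the following holds. Let $V$ be a finite-dimensional vector space over $\mathbb{F}$ and let $P\subset V\times V$ have density $\delta$, i.e. $|P|=\delta|V|^2$. Then there exist subspaces $W_1\leq V$ and $W_2\leq V$ of codimension $r_1$ and $r_2$ respectively, and a family $\mathbf{Q}=(Q_1,\ldots,Q_{r_3})$ of bilinear forms on $W_1\times W_2$, such that $$\phi_H\phi_V\phi_H(P)\supset\{(x,y)\in W_1\times W_2\mid Q_1(x,y)=\cdots=Q_{r_3}(x,y)=0\},$$ where $\max(r_1,r_2,r_3)\leq c(\delta)$. Moreover, $c(\delta)$ can be taken as $O(\exp(\exp(\exp(\log^{O(1)}\delta^{-1}))))$.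
   Context: For $P\subset V\times V$ define the vertical and horizontal operations $$P\stackrel{V}{\pm}P=\{(x,y_1\pm y_2)\mid (x,y_1)\in P,\ (x,y_2)\in P\},\qquad P\stackrel{H}{\pm}P=\{(x_1\pm x_2,y)\mid (x_1,y)\in P,\ (x_2,y)\in P\}.$$ The operation $\phi_V$ is $P\mapsto (P\stackrel{V}{+}P)\stackrel{V}{-}(P\stackrel{V}{+}P)$, that is, $\phi_V(P)=\{(x,y_1+y_2-y_3-y_4)\mid (x,y_i)\in P,\ i=1,\dots,4\}$. The operation $\phi_H$ is defined similarly with $H$ in place of $V$: $\phi_H(P)=\{(x_1+x_2-x_3-x_4,y)\mid (x_i,y)\in P,\ i=1,\dots,4\}$. The composition $\phi_H\phi_V\phi_H(P)$ means $\phi_H(\phi_V(\phi_H(P)))$. The constants implied by the $O(\cdot)$ notation may depend on $p$ but not on $\dim V$ or $\delta$. *)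

(* Defs.v *)
From mathcomp Require Import all_boot all_order all_algebra all_field.

Set Implicit Arguments.
Unset Strict Implicit.
Unset Printing Implicit Defensive.

Import Order.TTheory GRing.Theory Num.Theory.
Local Open Scope ring_scope.

Section DirectionalOperations.
Variable V : finZmodType.
Implicit Types (P : {set V * V}) (x y : V).

Definition addV P : {set V * V} :=
  [set z | [exists y1, exists y2,
     [&& (z.1, y1) \in P, (z.1, y2) \in P & z.2 == y1 + y2]]].

Definition subV P : {set V * V} :=
  [set z | [exists y1, exists y2,
     [&& (z.1, y1) \in P, (z.1, y2) \in P & z.2 == y1 - y2]]].

Definition addH P : {set V * V} :=
  [set z | [exists x1, exists x2,
     [&& (x1, z.2) \in P, (x2, z.2) \in P & z.1 == x1 + x2]]].

Definition subH P : {set V * V} :=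
  [set z | [exists x1, exists x2,
     [&& (x1, z.2) \in P, (x2, z.2) \in P & z.1 == x1 - x2]]].

Definition phiV P : {set V * V} := subV (addV P).

Definition phiH P : {set V * V} := subH (addH P).

Lemma phiVP P x y :
  reflect (exists y1 y2 y3 y4, [/\ (x, y1) \in P, (x, y2) \in P,
             (x, y3) \in P, (x, y4) \in P & y = y1 + y2 - y3 - y4])
          ((x, y) \in phiV P).
Proof.
apply: (iffP idP) => [|[y1 [y2 [y3 [y4 [P1 P2 P3 P4 ->]]]]]].
  rewrite inE => /existsP[a /existsP[b /and3P[]]] /=.
  rewrite inE => /existsP[y1 /existsP[y2 /and3P[P1 P2 /eqP/= ->]]].
  rewrite inE => /existsP[y3 /existsP[y4 /and3P[P3 P4 /eqP/= ->]]] /eqP->.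
  by exists y1, y2, y3, y4; split; rewrite // opprD addrA.
rewrite inE; apply/existsP; exists (y1 + y2); apply/existsP; exists (y3 + y4).
rewrite /= opprD addrA eqxx andbT !inE; apply/andP; split.
  by apply/existsP; exists y1; apply/existsP; exists y2; rewrite /= P1 P2 eqxx.
by apply/existsP; exists y3; apply/existsP; exists y4; rewrite /= P3 P4 eqxx.
Qed.

Lemma phiHP P x y :
  reflect (exists x1 x2 x3 x4, [/\ (x1, y) \in P, (x2, y) \in P,
             (x3, y) \in P, (x4, y) \in P & x = x1 + x2 - x3 - x4])
          ((x, y) \in phiH P).
Proof.
apply: (iffP idP) => [|[x1 [x2 [x3 [x4 [P1 P2 P3 P4 ->]]]]]].
  rewrite inE => /existsP[a /existsP[b /and3P[]]] /=.
  rewrite inE => /existsP[x1 /existsP[x2 /and3P[P1 P2 /eqP/= ->]]].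
  rewrite inE => /existsP[x3 /existsP[x4 /and3P[P3 P4 /eqP/= ->]]] /eqP->.
  by exists x1, x2, x3, x4; split; rewrite // opprD addrA.
rewrite inE; apply/existsP; exists (x1 + x2); apply/existsP; exists (x3 + x4).
rewrite /= opprD addrA eqxx andbT !inE; apply/andP; split.
  by apply/existsP; exists x1; apply/existsP; exists x2; rewrite /= P1 P2 eqxx.
by apply/existsP; exists x3; apply/existsP; exists x4; rewrite /= P3 P4 eqxx.
Qed.

End DirectionalOperations.

Section Subspaces.
Variables (K : fieldType) (V : vectType K).

Definition codimv (W : {vspace V}) : nat := (\dim {:V} - \dim W)%N.

Definition bilinear_form (W1 W2 : {vspace V}) : Type :=
  {bilinear subvs_of W1 -> subvs_of W2 -> K | *%R & *%R}.

End Subspaces.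

(* Main.v *)
Require Import Defs.
From HB Require Import structures.
From mathcomp Require Import all_boot all_order all_algebra all_field.
From mathcomp Require Import mxabelem.
From mathcomp Require Import reals sequences exp.
From mathcomp Require Import zify lra.

Set Implicit Arguments.
Unset Strict Implicit.
Unset Printing Implicit Defensive.

Import Order.TTheory GRing.Theory Num.Theory.

(** Write N = |V|, identify V with its dual, and let U^perp denote annihilators.

    Bogolyubov's theorem applied to the dense fibres of P turns phiH P into a
    family of subspaces: for y in a dense set Y, the fibre of phiH P over y
    contains U_y^perp for some U_y of dimension at most d = O(delta^-2).  If q
    is a representation y = y1 + y2 - y3 - y4 with all y_i in Y, then the fibre
    of phiV (phiH P) over y contains U_q^perp, where U_q is the sum of the four
    U_(y_i).  The last phiH adds two such subspaces, and
    U_q^perp + U_q'^perp = (U_q cap U_q')^perp.  So it is enough to find, for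
    each y in a subspace W2 of bounded codimension, two representations q, q'
    such that U_q cap U_q' lies in S_y = M + { y T : T in Phi }, where the
    subspace M of V and the space Phi of linear maps have bounded dimension and
    do not depend on y: orthogonality of x to M defines W1, and orthogonality of
    x to y T, for T in a basis of Phi, gives the bilinear equations.  The space
    W2 comes from Bogolyubov's theorem for Y, in the form that provides a
    positive proportion of all conceivable representations of each y in W2.

    The pair (M, Phi) is found by exhaustion ([exhaustion]).  An element of U_y
    is a F(y), where the rows of the matrix F(y) span U_y and a is a coefficient
    row.  As long as, for some a, the map y |-> a F(y) restricted to the y where
    it leaves S_y has large additive energy, it agrees on a positive proportion
    of V with an affine map ([approximate_hom_affine], which combines the
    theorems of Balog-Szemeredi-Gowers, Plunnecke and Freiman); this map is
    adjoined to (M, Phi).  Afterwards the low rank members of Phi are traded for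
    their images ([regularize]), so that each nonzero member of Phi has large
    rank modulo M.

    Then a vector w outside S_y lies in U_q for very few representations q of y
    ([few_reps_through]).  Indeed w is a sum of four terms a_i F(y_i).  If one
    of them is outside S_(y_i), low energy makes the equation rare, for each
    single y and w ([few_low_energy_solutions]).  If all four are structured,
    then w is congruent modulo M to a combination of the y_i by members of Phi,
    and these members do not cancel since w is not in S_y, so high rank makes
    the equation rare ([few_structured]).  Now fix any q': the space U_q' has at
    most p^(4d) elements, hence some q avoids all those that are not in S_y.

    As for the bound, energy is large when it exceeds p^(-O(d)) N^3, and
    Freiman's theorem costs one exponential, so the exhaustion takes p^(p^O(d))
    steps.  With d = O(delta^-2) all dimensions are at most
    exp (exp (O(delta^-2))), that is exp (exp (exp (O(log delta^-1)))).

    Densities are kept as inequalities between natural numbers: a set A of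
    density at least 1/D is one with N <= D * |A|. *)

Local Open Scope nat_scope.

(** * Counting in dense graphs *)

Lemma sum_bool_card (T : finType) (A : {set T}) (P : pred T) :
  \sum_(x in A) P x = #|[set x in A | P x]|.
Proof. by rewrite -big_mkcondr sum1_card; apply: eq_card => x; rewrite !inE. Qed.

Lemma Cauchy_Schwarz_nat (I : finType) (P : pred I) (x y : I -> nat) :
  (\sum_(i | P i) x i * y i) ^ 2 <=
  (\sum_(i | P i) x i ^ 2) * (\sum_(i | P i) y i ^ 2).
Proof.
rewrite -(leq_pmul2l (isT : 0 < 2)).
have -> : 2 * (\sum_(i | P i) x i * y i) ^ 2 =
    \sum_(i | P i) \sum_(j | P j) 2 * ((x i * y j) * (x j * y i)).
  rewrite -mulnn big_distrlr big_distrr /=; apply: eq_bigr => i _.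
  by rewrite big_distrr /=; apply: eq_bigr => j _; lia.
have -> : 2 * ((\sum_(i | P i) x i ^ 2) * (\sum_(i | P i) y i ^ 2)) =
    \sum_(i | P i) \sum_(j | P j) ((x i * y j) ^ 2 + (x j * y i) ^ 2).
  under [RHS]eq_bigr do rewrite big_split /=.
  rewrite big_split /= [X in _ = _ + X]exchange_big /= big_distrlr /= mul2n -addnn.
  by congr (_ + _); apply: eq_bigr => i _; apply: eq_bigr => j _; rewrite expnMn.
by apply: leq_sum => i _; apply: leq_sum => j _; apply: nat_Cauchy.
Qed.

Lemma card_pairs (T U : finType) (P : T -> U -> bool) :
  #|[set z : T * U | P z.1 z.2]| = \sum_x #|[set y | P x y]|.
Proof.
rewrite -sum1_card (eq_bigl (fun z : T * U => xpredT z.1 && P z.1 z.2)) => [|z]; last first.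
  by rewrite inE.
rewrite -(pair_big_dep xpredT P (fun _ _ => 1)) /=.
by apply: eq_bigr => x _; rewrite sum1_card; apply: eq_card => y; rewrite inE.
Qed.

Lemma card_pairs_swap (T U : finType) (P : T -> U -> bool) :
  #|[set z : T * U | P z.1 z.2]| = \sum_y #|[set x | P x y]|.
Proof.
rewrite card_pairs; under eq_bigr do rewrite -sum1_card.
rewrite (exchange_big_dep xpredT) //=; apply: eq_bigr => y _.
by rewrite -sum1_card; apply: eq_bigl => x; rewrite !inE.
Qed.

(** A dense graph has large vertex sets between which all pairs are joined by
    many paths of length three.  In the neighbourhood D of a typical vertex b0,
    almost all pairs have many common neighbours, because a pair with few common
    neighbours seldom falls into a common neighbourhood.  Dropping from D the
    vertices that lie in many bad pairs gives A', and B' consists of the vertices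
    with many neighbours in D. *)
Section PathLemma.
Variables (T : finType) (e : rel T) (A : {set T}) (N h g : nat).
Hypotheses (gE : g = 2 * h) (N_gt0 : 0 < N) (cardA : #|A| <= N).
Hypothesis many_edges :
  N ^ 2 <= h * \sum_(a in A) #|[set b in A | e a b]|.

Let deg a := #|[set b in A | e a b]|.
(* Vertices of small degree are discarded first, so that each vertex of D still
   sends many edges when B' is chosen. *)
Let A0 := [set a in A | N <= g * deg a].
Let nbr b := [set a in A0 | e a b].
Let codeg a a' := #|[set b in A | e a b && e a' b]|.
Let bad a a' := 16 * g ^ 3 * codeg a a' < N.
Let badpairs b := \sum_(a in nbr b) #|[set a' in nbr b | bad a a']|.

Let edgesA0 : N ^ 2 <= g * \sum_(a in A0) deg a.
Proof.
have low : g * \sum_(a in A :\: A0) deg a <= N ^ 2.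
  rewrite big_distrr /=; apply: (@leq_trans (\sum_(a in A :\: A0) N)).
    apply: leq_sum => a; rewrite !inE => /andP[nA aA].
    by move: nA; rewrite aA /= -ltnNge => /ltnW.
  rewrite sum_nat_const -mulnn leq_mul2r; apply/orP; right.
  by apply: leq_trans cardA; apply: subset_leq_card; apply: subsetDl.
have sub : A0 \subset A by apply/subsetP => a; rewrite inE => /andP[].
move: many_edges; rewrite (big_setID A0) /= (setIidPr sub) -/(deg _).
rewrite /deg in low *; lia.
Qed.

Let sum_nbr : \sum_(b in A) #|nbr b| = \sum_(a in A0) deg a.
Proof.
under eq_bigr do rewrite -sum_bool_card.
by rewrite exchange_big /=; apply: eq_bigr => a _; rewrite sum_bool_card.
Qed.

Let sum_nbr2 : N ^ 3 <= g ^ 2 * \sum_(b in A) #|nbr b| ^ 2.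
Proof.
have := Cauchy_Schwarz_nat (mem A) (fun=> 1) (fun b => #|nbr b|).
under eq_bigr do rewrite mul1n.
rewrite sum_nbr sum_nat_const muln1.
move=> CS; rewrite -(leq_pmul2l N_gt0).
apply: (@leq_trans ((g * \sum_(a in A0) deg a) ^ 2)).
  by rewrite -expnS (expnM N 2 2) leq_exp2r.
rewrite expnMn mulnCA leq_mul2l; apply/orP; right.
by apply: leq_trans CS _; rewrite leq_mul2r cardA orbT.
Qed.

Let sum_bad : 16 * g ^ 3 * \sum_(b in A) badpairs b <= N ^ 3.
Proof.
have -> : \sum_(b in A) badpairs b =
   \sum_(a in A0) \sum_(a' in A0 | bad a a') codeg a a'.
  transitivity (\sum_(b in A) \sum_(a in A0) \sum_(a' in A0 | bad a a')
                  (e a b && e a' b : nat)).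
    apply: eq_bigr => b _; rewrite /badpairs big_mkcond [RHS]big_mkcond /=.
    apply: eq_bigr => a _; rewrite inE; case: ifP => [/andP[-> eab]|].
      rewrite -sum_bool_card big_mkcond [RHS]big_mkcond /=.
      apply: eq_bigr => a' _; rewrite inE eab /=.
      by case: (a' \in A0) => //=; case: (bad a a'); case: (e a' b).
    case: (a \in A0) => //= ->; rewrite big1 //.
  rewrite exchange_big; apply: eq_bigr => a _ /=.
  rewrite exchange_big; apply: eq_bigr => a' _ /=.
  by rewrite sum_bool_card.
rewrite big_distrr /=.
apply: (@leq_trans (\sum_(a in A) \sum_(a' in A) N)); last first.
  by rewrite !sum_nat_const mulnA expnSr -mulnn !leq_mul.
have sub : A0 \subset A by apply/subsetP => a; rewrite inE => /andP[].
rewrite [X in _ <= X](big_setID A0) /= (setIidPr sub).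
apply: leq_trans (leq_addr _ _); apply: leq_sum => a _.
rewrite [X in _ <= X](big_setID A0) /= (setIidPr sub).
apply: leq_trans (leq_addr _ _); rewrite big_distrr /= big_mkcondr /=.
by apply: leq_sum => a' _; case: ifP => // /ltnW.
Qed.

Let good_vertex : exists2 b, b \in A &
  N ^ 2 + 32 * g ^ 3 * badpairs b <= 4 * g ^ 2 * #|nbr b| ^ 2.
Proof.
apply/exists_inP; apply: contraT; rewrite negb_exists_in => /forall_inP no.
have : 4 * g ^ 2 * \sum_(b in A) #|nbr b| ^ 2 <=
       \sum_(b in A) (N ^ 2 + 32 * g ^ 3 * badpairs b).
  by rewrite big_distrr; apply: leq_sum => b /no; rewrite -ltnNge => /ltnW.
rewrite big_split sum_nat_const -big_distrr /=.
have : #|A| * N ^ 2 <= N ^ 3 by rewrite (expnS N 2) leq_mul2r cardA orbT.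
have : 0 < N ^ 3 by rewrite expn_gt0 N_gt0.
move: sum_bad sum_nbr2.
rewrite -!mulnA; lia.
Qed.

Lemma many_paths : exists A' B' : {set T},
  [/\ A' \subset A, B' \subset A, N <= 4 * g * #|A'|, N <= 2 * g * #|B'| &
   forall a b, a \in A' -> b \in B' ->
     N ^ 2 <= 128 * g ^ 5 *
       #|[set z : T * T | [&& z.1 \in A, z.2 \in A, e a z.1, e z.2 z.1 & e z.2 b]]|].
Proof.
have [b0 b0A good] := good_vertex.
set D := nbr b0 in good.
have sub : A0 \subset A by apply/subsetP => a; rewrite inE => /andP[].
have subD : D \subset A0 by apply/subsetP => a; rewrite inE => /andP[].
have DA := subset_trans subD sub.
have g_gt0 : 0 < g.
  by rewrite lt0n; apply: contraTneq good => ->; rewrite muln0 mul0n -ltnNge ltn_addr // expn_gt0 N_gt0.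
have ND : N <= 2 * g * #|D|.
  rewrite -(@leq_exp2r _ _ 2) // !expnMn (_ : 2 ^ 2 = 4) //.
  by apply: leq_trans good; exact: leq_addr.
have badD : 8 * g * badpairs b0 <= #|D| ^ 2.
  rewrite -(@leq_pmul2l (4 * g ^ 2)) ?muln_gt0 ?expn_gt0 ?g_gt0 //.
  apply: leq_trans good; apply: leq_trans (leq_addl _ _).
  rewrite (expnS g 2); lia.
rewrite /badpairs -/D in badD.
clearbody D; clear good.
have D_gt0 : 0 < #|D|.
  by rewrite lt0n; apply: contraTneq ND => ->; rewrite muln0 -ltnNge.
pose nbad a := #|[set a' in D | bad a a']|.
have {}badD : 8 * g * \sum_(a in D) nbad a <= #|D| ^ 2 := badD.
pose A' := [set a in D | 4 * g * nbad a <= #|D|].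
pose dD b := #|[set a in D | e a b]|.
pose B' := [set b in A | #|D| <= 2 * g * dD b].
exists A', B'; split.
- by apply: subset_trans DA; apply/subsetP => a; rewrite inE => /andP[].
- by apply/subsetP => a; rewrite inE => /andP[].
- have : #|D :\: A'| * #|D| <= 4 * g * \sum_(a in D) nbad a.
    rewrite -sum_nat_const big_distrr /= [X in _ <= X](big_setID (D :\: A')) /=.
    rewrite (setIidPr (subsetDl _ _)); apply: leq_trans (leq_addr _ _).
    apply: leq_sum => a; rewrite !inE => /andP[+ aD]; rewrite aD /= -ltnNge.
    exact: ltnW.
  have : #|D| = #|A'| + #|D :\: A'|.
    rewrite -(cardsID A' D) (setIidPr _) //.
    by apply/subsetP => a; rewrite inE => /andP[].
  move=> cD small.
  have : 2 * #|D :\: A'| <= #|D|.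
    rewrite -(leq_pmul2r D_gt0) mulnn; apply: leq_trans badD; lia.
  move=> half; apply: leq_trans ND _.
  rewrite -[4]/(2 * 2) -!mulnA leq_pmul2l // mulnCA leq_pmul2l //; lia.
- have low : 2 * g * \sum_(b in A :\: B') dD b <= N * #|D|.
    rewrite big_distrr /=; apply: (@leq_trans (\sum_(b in A :\: B') #|D|)).
      apply: leq_sum => b; rewrite !inE => /andP[+ bA]; rewrite bA /= -ltnNge.
      exact: ltnW.
    rewrite sum_nat_const leq_mul2r; apply/orP; right.
    by apply: leq_trans cardA; apply: subset_leq_card; apply: subsetDl.
  have hi : \sum_(b in B') dD b <= #|B'| * #|D|.
    rewrite -sum_nat_const; apply: leq_sum => b _; apply: subset_leq_card.
    by apply/subsetP => a; rewrite inE => /andP[].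
  have tot : N * #|D| <= g * \sum_(b in A) dD b.
    have -> : \sum_(b in A) dD b = \sum_(a in D) deg a.
      under eq_bigr do rewrite /dD -sum_bool_card.
      by rewrite exchange_big /=; apply: eq_bigr => a _; rewrite sum_bool_card.
    rewrite big_distrr mulnC -sum_nat_const; apply: leq_sum => a aD.
    by move: (subsetP subD _ aD); rewrite inE => /andP[].
  have subB : B' \subset A by apply/subsetP => a; rewrite inE => /andP[].
  move: tot; rewrite (big_setID B') /= (setIidPr subB) => tot.
  rewrite -(leq_pmul2r D_gt0) -mulnA; move: low hi tot.
  rewrite -mulnA => low hi tot.
  have := leq_mul (leqnn g) hi; lia.
move=> a b; rewrite !inE => /andP[aD abad] /andP[bA bD].
pose gd a' := (a' \in D) && e a' b && ~~ bad a a'.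
have cgood : #|D| <= 4 * g * #|[set a' | gd a']|.
  have : dD b <= #|[set a' | gd a']| + nbad a.
    apply: leq_trans (leq_card_setU _ _); apply: subset_leq_card.
    by apply/subsetP => a'; rewrite !inE /gd => /andP[-> ->] /=; case: (bad a a').
  move=> le; have := leq_mul (leqnn (4 * g)) le; lia.
have paths : N * #|[set a' | gd a']| <= 16 * g ^ 3 *
  #|[set z : T * T | [&& z.1 \in A, z.2 \in A, e a z.1, e z.2 z.1 & e z.2 b]]|.
  have -> : #|[set z : T * T | [&& z.1 \in A, z.2 \in A, e a z.1, e z.2 z.1 & e z.2 b]]|
    = \sum_(a' in A | e a' b) codeg a a'.
    rewrite (card_pairs_swap (fun x y => [&& x \in A, y \in A, e a x, e y x & e y b])).
    rewrite [RHS]big_mkcond /=; apply: eq_bigr => a' _.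
    case: ifP => [/andP[a'A ea'b]|no]; last first.
      by apply: eq_card0 => x; rewrite inE; apply: contraFF no => /and5P[_ -> _ _ ->].
    by apply: eq_card => x; rewrite !inE a'A ea'b andbT.
  rewrite big_distrr /= mulnC -sum_nat_const.
  rewrite big_mkcond [X in _ <= X]big_mkcond /=; apply: leq_sum => a' _.
  rewrite inE /gd; case: (boolP (a' \in D)) => //= a'D.
  rewrite (subsetP DA _ a'D) /=; case: (e a' b) => //=.
  by rewrite -leqNgt; case: ifP.
apply: (@leq_trans (2 * g * #|D| * N)); first by rewrite -mulnn leq_mul2r ND orbT.
have := leq_mul (leqnn (2 * g * N)) cgood.
have := leq_mul (leqnn (8 * g ^ 2)) paths.
move: #|[set z | _]| #|[set a' | _]| => u v; rewrite (_ : g ^ 5 = g ^ 2 * g ^ 3) -?expnD //.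
move=> h1 h2.
apply: (@leq_trans (8 * g ^ 2 * (N * v))); first by rewrite -mulnn; lia.
by apply: leq_trans h1 _; lia.
Qed.
End PathLemma.

(** * Sumsets and additive energy *)

Section Sumsets.
Variable G : finZmodType.
Implicit Types (A B C X Y Z : {set G}) (x y z : G).

Definition sumset A B : {set G} := [set (a + b)%R | a in A, b in B].
Definition oppset A : {set G} := [set (- a)%R | a in A].

Lemma sumsetP A B x :
  reflect (exists a b, [/\ a \in A, b \in B & x = (a + b)%R]) (x \in sumset A B).
Proof.
apply: (iffP imset2P) => [[a b aA bB ->]|[a [b [aA bB ->]]]]; first by exists a, b.
by exists a b.
Qed.

Lemma mem_sumset A B a b : a \in A -> b \in B -> (a + b)%R \in sumset A B.
Proof. by move=> aA bB; apply/imset2P; exists a b. Qed.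

Lemma sumsetC A B : sumset A B = sumset B A.
Proof.
apply/setP => x; apply/sumsetP/sumsetP => -[a [b [aA bB ->]]];
  by exists b, a; rewrite addrC.
Qed.

Lemma sumsetA A B C : sumset A (sumset B C) = sumset (sumset A B) C.
Proof.
apply/setP => x; apply/sumsetP/sumsetP => [[a [y [aA /sumsetP[b [c [bB cC ->]]] ->]]]|].
  by exists (a + b)%R, c; rewrite mem_sumset // addrA.
move=> [y [c [/sumsetP[a [b [aA bB ->]]] cC ->]]].
by exists a, (b + c)%R; rewrite mem_sumset // addrA.
Qed.

Lemma mem_oppset A x : (x \in oppset A) = ((- x)%R \in A).
Proof.
apply/imsetP/idP => [[a aA ->]|xA]; first by rewrite opprK.
by exists (- x)%R; rewrite ?opprK.
Qed.

Lemma card_oppset A : #|oppset A| = #|A|.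
Proof. by apply: card_imset; apply: oppr_inj. Qed.

Lemma sumsetS A A' B B' : A \subset A' -> B \subset B' ->
  sumset A B \subset sumset A' B'.
Proof.
move=> /subsetP sA /subsetP sB; apply/subsetP => _ /sumsetP[a [b [aA bB ->]]].
by rewrite mem_sumset ?sA ?sB.
Qed.

Lemma sumset1 A x : sumset A [set x] = [set (a + x)%R | a in A].
Proof.
apply/setP => y; apply/sumsetP/imsetP => [[a [b [aA /set1P-> ->]]]|[a aA ->]].
  by exists a.
by exists a, x; rewrite set11.
Qed.

Lemma card_sumset1 A x : #|sumset A [set x]| = #|A|.
Proof. by rewrite sumset1 card_imset //; apply: addIr. Qed.

Lemma sumsetUr A B C : sumset A (B :|: C) = sumset A B :|: sumset A C.
Proof.
apply/setP => x; rewrite inE; apply/sumsetP/orP => [[a [b [aA]]]|].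
  by rewrite inE => /orP[] h ->; [left|right]; apply: mem_sumset.
by move=> [] /sumsetP[a [b [aA bB ->]]]; exists a, b; rewrite inE bB ?orbT.
Qed.

Lemma sumset_set0 A : sumset A set0 = set0.
Proof. by apply/setP => x; rewrite inE; apply/sumsetP => -[a [b []]]; rewrite inE. Qed.

(** Fixing a decomposition d = u - w for each difference d, the map
    (d, x) |-> (x + u, x + w) is injective: the difference of the two components
    recovers d, hence u, hence x. *)
Lemma Ruzsa_triangle X U W :
  #|sumset U (oppset W)| * #|X| <= #|sumset X U| * #|sumset X W|.
Proof.
pose f d := odflt (0, 0)%R
  [pick p : G * G | [&& p.1 \in U, p.2 \in W & d == (p.1 - p.2)%R]].
have fP d : d \in sumset U (oppset W) ->
    [/\ (f d).1 \in U, (f d).2 \in W & d = ((f d).1 - (f d).2)%R].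
  move=> /sumsetP[u [w [uU]]]; rewrite mem_oppset => wW ->.
  rewrite /f; case: pickP => [p /and3P[h1 h2 /eqP h3]|/(_ (u, - w)%R)] //=.
  by rewrite uU wW opprK eqxx.
rewrite -!cardsX.
pose h (z : G * G) := ((z.2 + (f z.1).1)%R, (z.2 + (f z.1).2)%R).
rewrite -(card_in_imset (f := h)).
  apply/subset_leq_card/subsetP => _ /imsetP[[d x] /setXP[/fP[dU dW _] xX] ->].
  by apply/setXP; rewrite !mem_sumset.
move=> [d x] [d' x'] /setXP[/fP[_ _ hd] _] /setXP[/fP[_ _ hd'] _] [e1 e2].
rewrite /= in hd hd' e1 e2.
have dd : d = d'.
  rewrite hd hd'; have := congr2 (fun a b => a - b)%R e1 e2.
  by rewrite !opprD ![(_ + _ + (- _ - _))%R]addrACA !subrr !add0r.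
by move: e1; rewrite dd => /addIr ->.
Qed.

(** Petridis' lemma: if X minimises the growth ratio |X + B| / |X| among its
    subsets, then adding B to X + C costs no more than that ratio.  When an
    element c is added to C, the new sums x + b + c are overcounted exactly for
    the x in Z, and minimality applied to Z compensates for this loss. *)
Lemma Petridis X B :
  (forall Z, Z \subset X -> #|sumset X B| * #|Z| <= #|sumset Z B| * #|X|) ->
  forall C, #|sumset X (sumset B C)| * #|X| <= #|sumset X B| * #|sumset X C|.
Proof.
move=> minX C; elim: {C}#|C| {-2}C (erefl #|C|) => [|m IH] C cC.
  by move/eqP: cC; rewrite cards_eq0 => /eqP->; rewrite !sumset_set0 cards0 mul0n.
have /set0Pn[c cC'] : C != set0 by rewrite -cards_eq0 cC.
have {}cC : #|C :\ c| = m by move: cC; rewrite (cardsD1 c) cC' => -[].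
have {IH cC} := IH _ cC; move: (setD1K cC'); rewrite setUC.
move: (C :\ c) => C0 <- IH.
rewrite !sumsetUr.
pose Z := [set x in X | sumset [set (x + c)%R] B \subset sumset X (sumset B C0)].
have ZX : Z \subset X by apply/subsetP => x; rewrite inE => /andP[].
have up : #|sumset X (sumset B C0) :|: sumset X (sumset B [set c])| + #|sumset Z B|
    <= #|sumset X (sumset B C0)| + #|sumset X B|.
  rewrite (sumsetA X B [set c]); set S := sumset X (sumset B C0).
  rewrite -(card_sumset1 (sumset X B) c) -(card_sumset1 (sumset Z B) c).
  rewrite -[leqRHS]cardsUI leq_add2l; apply: subset_leq_card.
  rewrite subsetI; apply/andP; split; last by rewrite !sumsetS.
  apply/subsetP => _ /sumsetP[_ [_ [/sumsetP[z [b [zZ bB ->]]] /set1P-> ->]]].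
  move: zZ; rewrite inE => /andP[_ /subsetP]; apply.
  by rewrite addrAC mem_sumset ?set11.
have lo : #|sumset X C0| + #|X| <= #|sumset X C0 :|: sumset X [set c]| + #|Z|.
  rewrite -(card_sumset1 X c) -cardsUI leq_add2l.
  rewrite -(card_sumset1 Z c); apply/subset_leq_card/subsetP => y.
  rewrite inE => /andP[/sumsetP[x [a [xX aC ->]]] /sumsetP[z [_ [zX /set1P-> e]]]].
  rewrite e mem_sumset ?set11 // inE zX -e /=.
  apply/subsetP => _ /sumsetP[_ [b [/set1P-> bB ->]]].
  by rewrite -addrA [(a + b)%R]addrC !mem_sumset.
move: (minX _ ZX) => min.
have := leq_mul up (leqnn #|X|); have := leq_mul (leqnn #|sumset X B|) lo.
rewrite !mulnDl !mulnDr; move: IH min.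
lia.
Qed.

Definition iter_sumset B k := iter k (sumset B) [set 0%R].

Lemma Plunnecke A B : A != set0 -> exists X, [/\ X \subset A, X != set0 &
  forall k, #|sumset X (iter_sumset B k)| * #|A| ^ k <= #|sumset A B| ^ k * #|X|].
Proof.
move=> A0.
pose P X := (X \subset A) && (X != set0).
have PA : P A by rewrite /P subxx.
pose ratio X : rat := (#|sumset X B|%:R / #|X|%:R)%R.
case: (Order.TotalTheory.arg_minP ratio PA) => X /andP[XA X0] Xmin.
have Xgt : (0 < #|X|%:R :> rat)%R by rewrite ltr0n card_gt0.
have minX Z : Z \subset A -> #|sumset X B| * #|Z| <= #|sumset Z B| * #|X|.
  have [->|Z0] := eqVneq Z set0; first by rewrite cards0 muln0.
  move=> ZA; have := Xmin Z; rewrite /P ZA Z0 => /(_ isT).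
  rewrite /ratio ler_pdivrMr // mulrAC ler_pdivlMr ?ltr0n ?card_gt0 //.
  by rewrite -!natrM ler_nat.
exists X; split=> //; elim=> [|k IH].
  by rewrite !expn0 muln1 mul1n /iter_sumset /= card_sumset1.
have := @Petridis X B _ (iter_sumset B k).
move=> /(_ (fun Z ZX => minX Z (subset_trans ZX XA))) pet.
have := minX A (subxx A) => mA.
have X_gt0 : 0 < #|X| by rewrite card_gt0.
rewrite -(leq_pmul2r X_gt0) !expnS.
change (iter_sumset B k.+1) with (sumset B (iter_sumset B k)).
apply: (@leq_trans (#|sumset X B| * #|sumset X (iter_sumset B k)| * (#|A| * #|A| ^ k))).
  by rewrite mulnAC leq_mul2r pet orbT.
apply: (@leq_trans ((#|sumset A B| * #|X|) * (#|sumset A B| ^ k * #|X|))).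
  by rewrite mulnACA leq_mul.
by rewrite -!mulnA leq_mul // mulnCA.
Qed.

Definition diffrep A x := #|[set b in A | (b + x)%R \in A]|.
Definition energy A := \sum_x diffrep A x ^ 2.

Lemma diffrep_le A x : diffrep A x <= #|A|.
Proof. by apply/subset_leq_card/subsetP => b; rewrite inE => /andP[]. Qed.

Lemma sum_diffrep A (S : {set G}) :
  \sum_(x in S) diffrep A x = \sum_(a in A) #|[set b in A | (a - b)%R \in S]|.
Proof.
under eq_bigr do rewrite /diffrep -sum_bool_card.
rewrite exchange_big /=; under [RHS]eq_bigr do rewrite -sum_bool_card.
rewrite [RHS]exchange_big /=; apply: eq_bigr => b _.
rewrite [RHS](reindex_inj (addrI b)) /= big_mkcond [RHS]big_mkcond /=.
apply: eq_bigr => x _; rewrite addrAC subrr add0r.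
by case: (x \in S); case: ((b + x)%R \in A).
Qed.

Lemma sum_diffrepT A : \sum_x diffrep A x = #|A| ^ 2.
Proof.
transitivity (\sum_(x in [set: G]) diffrep A x); first by apply: eq_bigl => x; rewrite inE.
rewrite sum_diffrep -mulnn -sum_nat_const; apply: eq_bigr => a _.
by apply: eq_card => b; rewrite !inE andbT.
Qed.

(** Join a and b when a - b is a popular difference; large energy makes this
    graph dense.  A path a, b', a', b gives a - b = (a - b') - (a' - b') + (a' - b)
    with three popular differences, so by [many_paths] each element of A' - B'
    has about N^2 representations by triples of popular differences, and there
    are only O(N) popular differences. *)
Lemma Balog_Szemeredi_Gowers A N K g : g = 4 * K -> 0 < N -> #|A| <= N -> N ^ 3 <= K * energy A ->
  exists A' B', [/\ A' \subset A, B' \subset A, N <= 4 * g * #|A'|,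
    N <= 2 * g * #|B'| & #|sumset A' (oppset B')| <= 16 * g ^ 8 * N].
Proof.
move=> gE N0 AN EA; pose h := 2 * K.
pose S := [set x | N <= h * diffrep A x].
have K0 : 0 < K.
  by rewrite lt0n; apply: contraTneq EA => ->; rewrite mul0n -ltnNge expn_gt0 N0.
have sumT : \sum_x diffrep A x <= N ^ 2 by rewrite sum_diffrepT leq_exp2r.
have split_sum (F : G -> nat) : \sum_x F x = \sum_(x in S) F x + \sum_(x in ~: S) F x.
  rewrite (bigID (mem S)) /=; congr (_ + _); apply: eq_bigl => x //.
  by rewrite in_setC.
have popular : N ^ 2 <= h * \sum_(x in S) diffrep A x.
  have low : h * \sum_(x in ~: S) diffrep A x ^ 2 <= N ^ 3.
    apply: (@leq_trans (N * \sum_x diffrep A x)); last first.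
      by rewrite (expnS N 2) leq_mul2l sumT orbT.
    rewrite (split_sum (diffrep A)) mulnDr; apply: leq_trans (leq_addl _ _).
    rewrite !big_distrr /=; apply: leq_sum => x; rewrite !inE -ltnNge => /ltnW le.
    by rewrite -mulnn mulnA leq_mul2r le orbT.
  have hi : \sum_(x in S) diffrep A x ^ 2 <= N * \sum_(x in S) diffrep A x.
    rewrite big_distrr /=; apply: leq_sum => x _; rewrite -mulnn leq_mul2r.
    by rewrite (leq_trans (diffrep_le A x)) ?orbT.
  move: EA; rewrite /energy split_sum => EA.
  rewrite -(leq_pmul2l N0) -(expnS N 2).
  have := leq_mul (leqnn h) hi; rewrite /h in low *; lia.
have Ssize : #|S| <= h * N.
  rewrite -(leq_pmul2r N0); apply: (@leq_trans (h * \sum_x diffrep A x)).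
    rewrite -sum_nat_const big_distrr /= [X in _ <= X](bigID (mem S)) /=.
    apply: leq_trans (leq_addr _ _); apply: leq_sum => x.
    by rewrite inE.
  by rewrite -mulnA mulnn leq_mul2l sumT orbT.
pose e a b := (a - b)%R \in S.
have gE2 : g = 2 * h by rewrite gE /h; lia.
have edges : N ^ 2 <= h * \sum_(a in A) #|[set b in A | e a b]|.
  by rewrite -sum_diffrep.
have [A' [B' [A'A B'A A'l B'l paths]]] := many_paths gE2 N0 AN edges.
exists A', B'; split => //.
pose T d := [set s : G * G * G | [&& s.1.1 \in S, s.1.2 \in S, s.2 \in S &
                                   (s.1.1 - s.1.2 + s.2)%R == d]].
have Tl d : d \in sumset A' (oppset B') -> N ^ 2 <= 128 * g ^ 5 * #|T d|.
  move=> /sumsetP[a [b [aA' bB' ->]]]; rewrite mem_oppset in bB'.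
  apply: leq_trans (paths _ _ aA' bB') _; rewrite leq_mul2l; apply/orP; right.
  set Q := [set z | _].
  pose f (z : G * G) := (((a - z.1)%R, (z.2 - z.1)%R), (z.2 + b)%R).
  rewrite -(card_imset _ (f := f)); last first.
    by move=> [x y] [x' y'] [] /addrI/oppr_inj-> _ /addIr->.
  apply/subset_leq_card/subsetP => _ /imsetP[[x y] + ->].
  rewrite !inE /e /= opprK => /and5P[_ _ h1 h2 h3]; rewrite !inE in h1 h2 h3.
  by rewrite h1 h2 h3 /= opprB (addrA (a - x)%R) subrK addrA subrK.
have sumT3 : \sum_(d in sumset A' (oppset B')) #|T d| <= #|S| ^ 3.
  rewrite 2!expnSr expn1 -!cardsX.
  apply: (@leq_trans (\sum_d #|T d|)).
    by rewrite [X in _ <= X](bigID (mem (sumset A' (oppset B')))) leq_addr.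
  have -> : \sum_d #|T d| = #|[set z : G * (G * G * G) | z.2 \in T z.1]|.
    rewrite (card_pairs (fun d s => s \in T d)); apply: eq_bigr => d _.
    by apply: eq_card => s; rewrite inE.
  rewrite -(card_in_imset (f := snd)).
    apply/subset_leq_card/subsetP => _ /imsetP[[d [[s1 s2] s3]] + ->].
    by rewrite !inE /= => /and4P[-> -> ->].
  move=> [d s] [d' s']; rewrite !inE /= => /and4P[_ _ _ /eqP dE] /and4P[_ _ _ /eqP d'E] ss.
  by rewrite -dE -d'E ss.
have cS3 : #|S| ^ 3 <= h ^ 3 * N ^ 3 by rewrite -expnMn leq_exp2r.
have all : #|sumset A' (oppset B')| * N ^ 2 <= 128 * g ^ 5 * (h ^ 3 * N ^ 3).
  apply: (@leq_trans (128 * g ^ 5 * \sum_(d in sumset A' (oppset B')) #|T d|)).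
    by rewrite -sum_nat_const big_distrr; apply: leq_sum => d; apply: Tl.
  by rewrite leq_mul2l (leq_trans sumT3 cS3) orbT.
rewrite -(@leq_pmul2r (N ^ 2)) ?expn_gt0 ?N0 //; apply: leq_trans all _.
have g3 : g ^ 3 = 8 * h ^ 3 by rewrite gE2 expnMn.
rewrite (expnD g 5 3) g3 (expnS N 2).
by move: (g ^ 5) (h ^ 3) (N ^ 2) => u v w; lia.
Qed.
End Sumsets.

Local Open Scope ring_scope.
Local Open Scope nat_scope.

(** * Approximate homomorphisms between vector spaces over F_p *)

Section Freiman.
Variables (p : nat) (p_prime : prime p).
Let F := 'F_p.

Definition spanmx m (B : {set 'rV['F_p]_m}) : 'M['F_p]_m := (\sum_(b in B) <<b>>)%MS.

Lemma mem_spanmx m (B : {set 'rV[F]_m}) b : b \in B -> (b <= spanmx B)%MS.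
Proof. by move=> bB; rewrite (sumsmx_sup b) // genmxE. Qed.

Lemma rank_spanmx m (B : {set 'rV[F]_m}) : \rank (spanmx B) <= #|B|.
Proof.
apply: leq_trans (mxrank_sum_leqif _) _ => /=.
rewrite -sum1_card; apply: leq_sum => b _.
by rewrite mxrank_gen rank_leq_row.
Qed.

Lemma card_rowspace m k (A : 'M[F]_(k, m)) :
  #|[set v : 'rV[F]_m | (v <= A)%MS]| = p ^ \rank A.
Proof.
transitivity (#|F| ^ \rank A); last by congr (_ ^ _); apply: card_Fp.
by rewrite -card_rowg; apply: eq_card => v; rewrite !inE.
Qed.

Lemma card_rVp m : #|{: 'rV[F]_m}| = p ^ m.
Proof. by rewrite card_mx mul1n; congr (_ ^ _); apply: card_Fp. Qed.

(** Over F_p scalars are sums of ones, so the span of B is reached from 0 by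
    adding elements of B. *)
Lemma spanmx_ind m (B : {set 'rV[F]_m}) (Q : 'rV[F]_m -> Prop) :
  Q 0%R -> (forall x b, Q x -> b \in B -> Q (x + b)%R) ->
  forall x, (x <= spanmx B)%MS -> Q x.
Proof.
move=> Q0 QB x /sub_sumsmxP[u ->].
apply: big_rec => // b y bB Qy.
have /submxP[w ->] : (u b *m <<b>> <= b)%MS.
  by rewrite (submx_trans (submxMl _ _)) ?genmxE.
rewrite [w]mx11_scalar mul_scalar_mx addrC.
rewrite -[w 0%R 0%R]natr_Zp scaler_nat.
elim: (w 0%R 0%R : nat) => [|k IH]; first by rewrite mulr0n addr0.
by rewrite mulrSr addrA; apply: QB.
Qed.

Lemma card_sumset_le (G : finZmodType) (A B : {set G}) : #|sumset A B| <= #|A| * #|B|.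
Proof.
rewrite -cardsX; apply: leq_trans (leq_imset_card (fun z : G * G => (z.1 + z.2)%R) _).
by apply/subset_leq_card/subsetP => _ /sumsetP[a [b [aA bB ->]]]; apply/imsetP; exists (a, b); rewrite ?inE ?aA.
Qed.

Lemma sumset_zero (G : finZmodType) (A : {set G}) : sumset A [set 0%R] = A.
Proof. by rewrite sumset1 -[RHS]imset_id; apply: eq_imset => x; rewrite addr0. Qed.

(** Take Y maximal among the subsets of Z whose translates Y + B are disjoint:
    then each z + B meets some y + B. *)
Lemma Ruzsa_covering (G : finZmodType) (Z B : {set G}) :
  exists2 Y : {set G}, #|Y| * #|B| <= #|sumset Z B| &
    forall z, z \in Z -> B != set0 -> exists y b b',
      [/\ y \in Y, b \in B, b' \in B & z = (y + b - b')%R].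
Proof.
pose P (Y : {set G}) := (Y \subset Z) && (#|Y| * #|B| <= #|sumset Y B|).
have P0 : P set0 by rewrite /P sub0set cards0.
case: (arg_maxnP (fun Y : {set G} => #|Y|) P0) => Y /andP[YZ YB] Ymax.
exists Y; first by apply: leq_trans YB _; rewrite subset_leq_card // sumsetS.
move=> z zZ B0.
have [/exists_inP[y yY /exists_inP[b bB zyb]]|none] :=
  boolP [exists y in Y, exists b in B, (y + b - z)%R \in B].
  by exists y, b, (y + b - z)%R; split => //; rewrite subKr.
have zY : z \notin Y.
  apply: contra none => zY; have /set0Pn[b bB] := B0.
  by apply/exists_inP; exists z => //; apply/exists_inP; exists b; rewrite // addrAC subrr add0r.
suff Pz : P (z |: Y) by have := Ymax _ Pz; rewrite /= cardsU1 zY add1n ltnn.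
  rewrite /P cardsU1 zY add1n subUset sub1set zZ YZ /= mulSn [sumset _ _]sumsetC sumsetUr.
  rewrite cardsU (sumsetC B Y) (sumsetC B [set z]).
  have -> : sumset [set z] B :&: sumset Y B = set0.
    apply/eqP; rewrite -subset0; apply/subsetP => x; rewrite inE => /andP[].
    move=> /sumsetP[_ [b [/set1P-> bB ->]]] /sumsetP[y [b' [yY b'B e]]].
    case/negP: none; apply/exists_inP; exists y => //; apply/exists_inP; exists b' => //.
    by rewrite -e addrAC subrr add0r.
  by rewrite cards0 subn0 (sumsetC [set z]) card_sumset1 leq_add2l.
Qed.

(** Plunnecke's inequality bounds 3B - B, so Ruzsa's covering lemma yields a
    bounded set Y with 2B - B contained in Y + B - B.  By induction every
    iterated sum of B lies in span Y + B - B, which is the whole span of B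
    because F_p has positive characteristic. *)
Lemma Freiman m (A B : {set 'rV[F]_m}) L : A != set0 -> B != set0 ->
  #|sumset A B| <= L * #|A| ->
  exists2 s, s * #|B| <= L ^ 4 * #|A| &
    #|[set v : 'rV[F]_m | (v <= spanmx B)%MS]| <= p ^ s * (L ^ 2 * #|A|).
Proof.
move=> A0 B0 AB; have [X [XA X0 pl]] := Plunnecke B A0.
have {AB} {}pl k : #|sumset X (iter_sumset B k)| <= L ^ k * #|X|.
  have A_gt0 : 0 < #|A| ^ k by rewrite expn_gt0 card_gt0 A0.
  rewrite -(leq_pmul2r A_gt0); apply: leq_trans (pl k) _.
  rewrite mulnAC -expnMn leq_mul2r; apply/orP; right.
  by case: k {A_gt0} => // k; rewrite leq_exp2r.
have X_gt0 : 0 < #|X| by rewrite card_gt0.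
have cXA : #|X| <= #|A| by apply: subset_leq_card.
have it1 : iter_sumset B 1 = B by rewrite /iter_sumset /= sumset_zero.
have it3 : iter_sumset B 3 = sumset B (sumset B B) by rewrite /iter_sumset /= sumset_zero.
have [b0 b0B] := set0Pn _ B0.
pose Z := sumset (sumset B B) (oppset B).
have [Y Ysmall cov] := Ruzsa_covering Z B.
exists #|Y|.
  apply: leq_trans Ysmall _.
  rewrite /Z -sumsetA (sumsetC (oppset B)) sumsetA (sumsetC _ B) -it3.
  rewrite -(leq_pmul2r X_gt0) -{2}it1; apply: leq_trans (Ruzsa_triangle _ _ _) _.
  apply: leq_trans (leq_mul (pl 3) (pl 1)) _.
  by rewrite mulnACA -(expnD L 3 1) mulnA leq_mul // leq_mul.
have BB : #|sumset B (oppset B)| <= L ^ 2 * #|A|.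
  rewrite -(leq_pmul2r X_gt0) -{1 2}it1; apply: leq_trans (Ruzsa_triangle _ _ _) _.
  apply: leq_trans (leq_mul (pl 1) (pl 1)) _.
  by rewrite mulnACA -(expnD L 1 1) mulnA leq_mul // leq_mul.
pose Q x := exists y b b', [/\ (y <= spanmx Y)%MS, b \in B, b' \in B & x = (y + b - b')%R].
have Qspan : forall x, (x <= spanmx B)%MS -> Q x.
  apply: spanmx_ind; first by exists 0%R, b0, b0; rewrite sub0mx add0r subrr.
  move=> _ b'' [y [b [b' [yY bB b'B ->]]]] b''B.
  have zZ : (b + b'' - b')%R \in Z.
    by apply: mem_sumset; [apply: mem_sumset | rewrite mem_oppset opprK].
  have [y' [c [c' [y'Y cB c'B e]]]] := cov _ zZ B0.
  exists (y + y')%R, c, c'; split => //; first by rewrite addmx_sub // mem_spanmx.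
  by move: e; rewrite -!addrA [(- b' + _)%R]addrC => ->.
apply: (@leq_trans #|sumset [set y | (y <= spanmx Y)%MS] (sumset B (oppset B))|).
  apply/subset_leq_card/subsetP => x; rewrite inE => /Qspan[y [b [b' [yY bB b'B ->]]]].
  by rewrite -addrA !mem_sumset // ?mem_oppset ?opprK ?inE.
apply: leq_trans (card_sumset_le _ _) _; rewrite card_rowspace leq_mul //.
by rewrite leq_exp2l ?prime_gt1 // rank_spanmx.
Qed.

Definition graph n (B : {set 'rV[F]_n}) (f : 'rV[F]_n -> 'rV[F]_n) : {set 'rV[F]_(n + n)} :=
  [set row_mx y (f y) | y in B].

Lemma card_graph n (B : {set 'rV[F]_n}) f : #|graph B f| = #|B|.
Proof. by rewrite card_imset // => x y /eq_row_mx[]. Qed.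

(** A dense piece of the graph of f has small doubling, hence spans a subspace
    of size O(N).  That subspace is an extension of a subspace of V by a
    bounded vertical fibre H0; a linear section T of the projection leaves
    f y - y T in H0, and the most frequent value of this difference gives v. *)
Lemma approximate_hom_affine n (B : {set 'rV[F]_n}) (f : 'rV[F]_n -> 'rV[F]_n) K g L :
  g = 4 * K -> L = 64 * g ^ 9 -> (p ^ n) ^ 3 <= K * energy (graph B f) ->
  exists T v, p ^ n <= 4 * g ^ 2 * (p ^ (2 * g * L ^ 4) * L ^ 2) *
     #|[set y in B | f y == (y *m T + v)%R]|.
Proof.
move=> gE LE hE; set N := p ^ n in hE *.
have N0 : 0 < N by rewrite expn_gt0 prime_gt0.
have cB : #|graph B f| <= N.
  by rewrite card_graph; apply: leq_trans (max_card _) _; rewrite card_rVp.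
have [A' [B' [A'G B'G A'l B'l AB]]] := Balog_Szemeredi_Gowers gE N0 cB hE.
have A'N : #|A'| <= N by apply: leq_trans cB; apply: subset_leq_card.
have A'0 : A' != set0.
  by apply: contraTneq A'l => ->; rewrite cards0 muln0 -ltnNge.
have B'0 : B' != set0.
  by apply: contraTneq B'l => ->; rewrite cards0 muln0 -ltnNge.
have oB'0 : oppset B' != set0 by rewrite -card_gt0 card_oppset card_gt0.
have small : #|sumset A' (oppset B')| <= L * #|A'|.
  apply: leq_trans AB _; apply: leq_trans (leq_mul (leqnn _) A'l) _.
  by rewrite LE (expnS g 8); move: (g ^ 8) => u; lia.
have [s s_small span_small] := Freiman A'0 oB'0 small.
rewrite card_oppset in s_small.
have {}s_small : s <= 2 * g * L ^ 4.
  have B'_gt0 : 0 < #|B'| by rewrite card_gt0.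
  rewrite -(leq_pmul2r B'_gt0); apply: leq_trans s_small _.
  apply: (@leq_trans (L ^ 4 * N)); first by rewrite leq_mul2l A'N orbT.
  by rewrite mulnAC mulnC leq_mul2r B'l orbT.
set h := spanmx (oppset B') in span_small.
have B'h b : b \in B' -> (b <= h)%MS.
  by move=> bB; rewrite -[b]opprK -scaleN1r scalemx_sub // mem_spanmx // mem_oppset opprK.
(* A linear section: y T is a second coordinate over y inside the span, for y in
   the first projection of the span. *)
pose T := (pinvmx (lsubmx h) *m rsubmx h)%R.
have Th (y : 'rV_n) v : (row_mx y v <= h)%MS -> (row_mx y (y *m T) <= h)%MS.
  case/submxP => w; rewrite -[h in RHS]hsubmxK mul_mx_row => /eq_row_mx[yE _].
  rewrite /T mulmxA; set w' := (y *m pinvmx _)%R.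
  suff -> : row_mx y (w' *m rsubmx h) = (w' *m h)%R by apply: submxMl.
  rewrite -[h in RHS]hsubmxK mul_mx_row; congr row_mx.
  by rewrite /w' mulmxKpV // yE submxMl.
pose B1 := [set y in B | row_mx y (f y) \in B'].
have cB1 : #|B1| = #|B'|.
  rewrite -(card_imset _ (f := fun y => row_mx y (f y))); last by move=> x y /eq_row_mx[].
  apply: eq_card => x; apply/imsetP/idP => [[y + ->]|xB']; first by rewrite inE => /andP[].
  have := subsetP B'G _ xB' => /imsetP[y yB e].
  by exists y; rewrite // inE yB -e.
pose H0 := [set v : 'rV[F]_n | (row_mx 0 v <= h)%MS].
have cH : #|B1| * #|H0| <= #|[set v : 'rV[F]_(n + n) | (v <= h)%MS]|.
  rewrite -cardsX.
  pose q (z : 'rV[F]_n * 'rV[F]_n) := row_mx z.1 (f z.1 + z.2)%R.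
  rewrite -(card_imset _ (f := q)); last first.
    by move=> [x y] [x' y'] /eq_row_mx[/= -> /addrI->].
  apply/subset_leq_card/subsetP => _ /imsetP[[y v] /setXP[+ +] ->].
  rewrite !inE /q /= => /andP[_ yB'] vh.
  have -> : row_mx y (f y + v)%R = (row_mx y (f y) + row_mx 0 v)%R.
    by rewrite add_row_mx addr0.
  by rewrite addmx_sub // B'h.
have inH0 y : y \in B1 -> (f y - y *m T)%R \in H0.
  rewrite !inE => /andP[_ /B'h yh].
  have -> : row_mx 0 (f y - y *m T)%R = (row_mx y (f y) - row_mx y (y *m T))%R.
    by rewrite opp_row_mx add_row_mx subrr.
  by rewrite addmx_sub // eqmx_opp (Th _ _ yh).
have sumB1 : #|B1| = \sum_(v in H0) #|[set y in B1 | (f y - y *m T)%R == v]|.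
  under eq_bigr do rewrite -sum_bool_card.
  rewrite exchange_big -sum1_card; apply: eq_bigr => y yB1 /=.
  rewrite (bigD1 (f y - y *m T)%R) ?inH0 //= eqxx big1 // => v /andP[_ /negbTE].
  by rewrite eq_sym => ->.
have [v vH0 popular] : exists2 v, v \in H0 &
    #|B1| <= #|H0| * #|[set y in B1 | (f y - y *m T)%R == v]|.
  apply/exists_inP; apply: contraT; rewrite negb_exists_in => /forall_inP no.
  have H00 : 0 < #|H0| by rewrite card_gt0; apply/set0Pn; exists 0%R; rewrite inE row_mx0 sub0mx.
  have : #|H0| * #|B1| < #|H0| * #|B1|.
    rewrite {1}sumB1 big_distrr /= -sum_nat_const.
    have [v0 v0H] : exists v0, v0 \in H0 by apply/set0Pn; rewrite -card_gt0.
    rewrite (bigD1 v0) //= [X in _ < X](bigD1 v0) //= -addSn leq_add //.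
      by rewrite ltnNge no.
    by apply: leq_sum => v /andP[vH _]; rewrite ltnW // ltnNge no.
  by rewrite ltnn.
exists T, v.
set E := [set y in B | _].
have popE : #|[set y in B1 | (f y - y *m T)%R == v]| <= #|E|.
  apply/subset_leq_card/subsetP => y; rewrite !inE => /andP[/andP[-> _] /eqP<-] /=.
  by rewrite addrC subrK.
have sq : #|B1| ^ 2 <= p ^ s * (L ^ 2 * #|A'|) * #|E|.
  rewrite -mulnn; apply: (@leq_trans (#|B1| * (#|H0| * #|E|))).
    by rewrite leq_mul2l (leq_trans popular) ?orbT // leq_mul2l popE orbT.
  by rewrite mulnA leq_mul2r (leq_trans cH span_small) orbT.
rewrite -(leq_pmul2l N0) mulnn.
apply: (@leq_trans ((2 * g * #|B1|) ^ 2)); first by rewrite leq_exp2r // cB1.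
have {}sq : #|B1| ^ 2 <= p ^ (2 * g * L ^ 4) * (L ^ 2 * N) * #|E|.
  apply: leq_trans sq _; rewrite leq_mul2r leq_mul ?orbT //.
    by rewrite leq_exp2l ?prime_gt1.
  by rewrite leq_mul2l A'N orbT.
rewrite !expnMn; move: (#|B1| ^ 2) (p ^ _) (L ^ 2) (g ^ 2) sq => u w z x sq.
by have := leq_mul (leqnn (4 * x)) sq; lia.
Qed.
End Freiman.

Local Open Scope ring_scope.

(** * Bogolyubov's theorem with many representations *)

(** A representation x = y1 + y2 - y3 - y4 is recorded by its first three terms;
    the last one is y1 + y2 - y3 - x. *)
Definition reps (G : finZmodType) (A : {set G}) (x : G) : {set G * G * G} :=
  [set q | [&& q.1.1 \in A, q.1.2 \in A, q.2 \in A & q.1.1 + q.1.2 - q.2 - x \in A]].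

Section Bogolyubov.
Variables (p : nat) (p_prime : prime p) (n : nat).
Let F := 'F_p.
Let V := 'rV[F]_n.
Let N := (p ^ n)%N.

Definition dot (x y : V) : F := (x *m y^T) 0 0.

Lemma dotDl x y z : dot (x + y) z = dot x z + dot y z.
Proof. by rewrite /dot mulmxDl mxE. Qed.

Lemma dotDr x y z : dot z (x + y) = dot z x + dot z y.
Proof. by rewrite /dot linearD mulmxDr mxE. Qed.

Lemma dotNr x z : dot z (- x) = - dot z x.
Proof. by rewrite /dot linearN mulmxN mxE. Qed.

Lemma dot0l x : dot 0 x = 0.
Proof. by rewrite /dot mul0mx mxE. Qed.

Lemma dot0r x : dot x 0 = 0.
Proof. by rewrite /dot trmx0 mulmx0 mxE. Qed.

Let card_V : #|{: V}| = N.
Proof. exact: card_rVp. Qed.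

Let omega : algC := sval (C_prim_root_exists (prime_gt0 p_prime)).
Let omegaP : p.-primitive_root omega.
Proof. by rewrite /omega; case: C_prim_root_exists. Qed.

Let chi (c : F) : algC := omega ^+ c.

Let chiD c d : chi (c + d) = chi c * chi d.
Proof.
rewrite /chi -exprD -(prim_expr_mod omegaP (c + d)%N).
congr (_ ^+ _); rewrite /=; congr (_ %% _)%N; exact: Fp_cast.
Qed.

Let chi0 : chi 0 = 1. Proof. by []. Qed.

Let norm_chi c : `|chi c| = 1.
Proof.
have /eqP w1 : `|omega| == 1.
  by rewrite -(@pexpr_eq1 _ _ p) ?prime_gt0 // -normrX (prim_expr_order omegaP) normr1.
by rewrite normrX w1 expr1n.
Qed.

Let conj_chi c : (chi c)^* = chi (- c).
Proof.
have c_neq0 : chi c != 0 by rewrite -normr_gt0 norm_chi.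
apply: (mulfI c_neq0); rewrite -chiD subrr chi0.
by rewrite -normCK norm_chi expr1n.
Qed.

Let orthogonality x : \sum_(l : V) chi (dot l x) = (N * (x == 0))%:R.
Proof.
have [->|x0] := eqVneq x 0.
  under eq_bigr do rewrite dot0r chi0.
  by rewrite sumr_const card_V muln1.
have [mu mux] : exists mu, dot mu x = 1.
  have /existsP[i xi] : [exists i, x 0 i != 0].
    apply: contraNT x0; rewrite negb_exists => /forallP h.
    by apply/eqP/rowP => i; rewrite mxE; apply/eqP; have := h i; rewrite negbK.
  exists ((x 0 i)^-1 *: delta_mx 0 i).
  by rewrite /dot -scalemxAl mxE -rowE !mxE mulVf.
rewrite muln0; set S := \sum_l _.
have : S = omega * S.
  rewrite {1}/S (reindex_inj (addrI mu)) /= /S big_distrr /=.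
  by apply: eq_bigr => l _; rewrite dotDl mux chiD.
move/eqP; rewrite -subr_eq0 -{1}[S]mul1r -mulrBl mulf_eq0 => /orP[|/eqP//].
rewrite subr_eq0 eq_sym => /eqP w1.
by have := eq_prim_root_expr omegaP 1 0; rewrite w1 expr1n eqxx mod0n modn_small ?prime_gt1.
Qed.

Variable A : {set V}.
Let f l := \sum_(a in A) chi (dot l a).

Let f_norm2 l : `|f l| ^+ 2 = \sum_(z in setX A A) chi (dot l (z.1 - z.2)).
Proof.
rewrite normCK rmorph_sum big_distrlr /= pair_big_dep /=.
apply: eq_big => [[a b]|z _]; first by rewrite in_setX.
by rewrite conj_chi -chiD dotDr dotNr.
Qed.

Let Parseval : \sum_l `|f l| ^+ 2 = (N * #|A|)%:R.
Proof.
under eq_bigr do rewrite f_norm2.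
rewrite exchange_big /=; under eq_bigr do rewrite orthogonality.
rewrite -natr_sum -big_distrr /=; congr (_ * _)%:R.
rewrite sum_bool_card; transitivity #|[set (a, a) | a in A]|; last first.
  by rewrite card_imset // => a b [].
apply: eq_card => -[a b]; rewrite !inE /= subr_eq0.
apply/andP/imsetP => [[/andP[aA bA] /eqP<-]|[c cA [-> ->]]]; first by exists a.
by rewrite cA.
Qed.

Let fourth_moment x : \sum_l `|f l| ^+ 4 * chi (- dot l x) =
  (N * #|[set q : (V * V) * (V * V) | [&& q.1 \in setX A A, q.2 \in setX A A &
     q.1.1 - q.1.2 + (q.2.1 - q.2.2) - x == 0]]|)%:R.
Proof.
pose S l := \sum_(z in setX A A) \sum_(w in setX A A) chi (dot l (z.1 - z.2 + (w.1 - w.2) - x)).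
transitivity (\sum_l S l).
  apply: eq_bigr => l _; rewrite (exprM _ 2 2) f_norm2 expr2 big_distrlr /=.
  rewrite big_distrl /=; apply: eq_bigr => z _; rewrite big_distrl /=.
  by apply: eq_bigr => w _; rewrite -!chiD -dotDr -dotNr -dotDr.
rewrite exchange_big /=; under eq_bigr do rewrite exchange_big /=.
under eq_bigr => z _ do under eq_bigr => w _ do rewrite orthogonality.
under eq_bigr do rewrite -natr_sum -big_distrr /= sum_bool_card.
rewrite -natr_sum -big_distrr /=; congr (_ * _)%:R.
rewrite (card_pairs (fun z w => [&& z \in setX A A, w \in setX A A & z.1 - z.2 + (w.1 - w.2) - x == 0])).
rewrite big_mkcond /=; apply: eq_bigr => z _.
case: ifP => zA; last by apply/esym/eq_card0 => w; rewrite inE.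
by apply: eq_card => w; rewrite [LHS]inE [RHS]inE.
Qed.

(* The large spectrum of A.  Parseval bounds its size by 2 (N / |A|)^2, and the
   frequencies outside it contribute at most half of the main term |A|^4 of the
   fourth moment. *)
Let K := [set l | (#|A| ^ 3)%:R <= (2 * N)%:R * `|f l| ^+ 2].

Let f0 : f 0 = #|A|%:R.
Proof.
by rewrite /f; under eq_bigr do rewrite dot0l chi0; rewrite sumr_const.
Qed.

Let zeroK : 0 \in K.
Proof.
rewrite inE f0 normr_nat -natrX -natrM ler_nat (expnS _ 2) leq_mul2r; apply/orP; right.
by rewrite (leq_trans (max_card _)) // card_V leq_pmull.
Qed.

Let cardK : (#|K| * #|A| ^ 2 <= 2 * N ^ 2)%N.
Proof.
have [->|A0] := posnP #|A|; first by rewrite muln0.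
rewrite -(leq_pmul2r A0) -mulnA -expnSr -(ler_nat algC) natrM -sumr_const.
rewrite big_distrl /=; under eq_bigr do rewrite mul1r.
apply: (@le_trans _ _ (\sum_l (2 * N)%:R * `|f l| ^+ 2)).
  rewrite big_mkcond /=; apply: ler_sum => l _; rewrite inE.
  by case: ifP => // _; rewrite mulr_ge0 ?exprn_ge0 ?ler0n.
by rewrite -big_distrr /= Parseval -natrM ler_nat -mulnn !mulnA.
Qed.

Let rep_large x : (forall l, l \in K -> dot l x = 0) -> (#|A| ^ 4 <= 2 * N * #|reps A x|)%N.
Proof.
move=> xK; set Q := [set q : (V * V) * (V * V) | [&& q.1 \in setX A A, q.2 \in setX A A &
     q.1.1 - q.1.2 + (q.2.1 - q.2.2) - x == 0]].
have Qrep : (#|Q| <= #|reps A x|)%N.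
  pose h (q : (V * V) * (V * V)) := (q.1.1, q.2.1, q.1.2).
  have hE (q : (V * V) * (V * V)) : q \in Q -> q.2.2 = q.1.1 + q.2.1 - q.1.2 - x.
    rewrite inE => /and3P[_ _ /eqP e]; apply/eqP; rewrite eq_sym -subr_eq0 -e.
    apply/eqP; rewrite -!addrA; congr (_ + _).
    rewrite addrCA; congr (_ + _).
    by congr (_ + _); rewrite addrC.
  rewrite -(card_in_imset (f := h)).
    apply/subset_leq_card/subsetP => _ /imsetP[[[a b] [c d]] qQ ->].
    rewrite inE /= -(hE _ qQ) /=; move: qQ; rewrite inE => /and3P[/setXP[-> ->] /setXP[-> ->]] //.
  move=> [[a b] [c d]] [[a' b'] [c' d']] /hE/= -> /hE/= -> [-> -> ->] //.
apply: (@leq_trans (2 * N * #|Q|)); last by rewrite leq_mul2l Qrep orbT.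
have main := fourth_moment x; rewrite -/Q in main.
rewrite (bigID (mem K)) /= in main.
have mainK : \sum_(l in K) `|f l| ^+ 4 * chi (- dot l x) = \sum_(l in K) `|f l| ^+ 4.
  by apply: eq_bigr => l /xK->; rewrite oppr0 chi0 mulr1.
rewrite {}mainK in main; set sK := \sum_(l in K) _ in main.
have sK_ge : (#|A| ^ 4)%:R <= sK.
  rewrite /sK (bigD1 0) //= f0 normr_nat -natrX lerDl.
  by apply: sumr_ge0 => l _; rewrite exprn_ge0.
set e := \sum_(l | l \notin K) _ in main.
have e_small : (2 * N)%:R * `|e| <= (#|A| ^ 4 * N)%:R.
  apply: (@le_trans _ _ ((2 * N)%:R * \sum_(l | l \notin K) `|f l| ^+ 4)).
    rewrite ler_wpM2l ?ler0n //; apply: le_trans (ler_norm_sum _ _ _) _.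
    by apply: ler_sum => l _; rewrite normrM norm_chi mulr1 normrX normr_id.
  apply: (@le_trans _ _ ((#|A| ^ 3)%:R * \sum_l `|f l| ^+ 2)); last first.
    by rewrite Parseval -natrM ler_nat; lia.
  rewrite !big_distrr /= big_mkcond /=; apply: ler_sum => l _.
  case: ifP => [lK|_]; last by rewrite mulr_ge0 ?exprn_ge0 ?ler0n.
  rewrite (exprM _ 2 2) expr2 mulrA ler_wpM2r ?exprn_ge0 //.
  move: lK; rewrite inE -real_ltNge ?ger0_real ?mulr_ge0 ?exprn_ge0 ?ler0n //.
  exact: ltW.
have eE : e = (N * #|Q|)%:R - sK.
  by rewrite -main [_ + e]addrC addrK.
have sK_real : sK \is Num.real.
  by apply: rpred_sum => l _; rewrite ger0_real // exprn_ge0.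
have : sK - (N * #|Q|)%:R <= `|e|.
  by rewrite eE distrC real_ler_norm // rpredB // realn.
rewrite lerBlDr => h.
have N0 : (0 < N)%N by rewrite expn_gt0 prime_gt0.
have : (2 * N)%:R * (#|A| ^ 4)%:R <= (#|A| ^ 4 * N)%:R + (2 * N)%:R * (N * #|Q|)%:R :> algC.
  apply: (@le_trans _ _ ((2 * N)%:R * (`|e| + (N * #|Q|)%:R))).
    by rewrite ler_wpM2l ?ler0n // (le_trans sK_ge).
  by rewrite mulrDr lerD2r.
rewrite -!natrM -natrD ler_nat => h2.
rewrite -(leq_pmul2r N0); lia.
Qed.

(** The number of representations of x is a Fourier sum of the values
    |f l|^4 chi (- dot l x).  For x orthogonal to the large spectrum all its
    large terms are nonnegative, and l = 0 alone contributes |A|^4. *)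
Theorem Bogolyubov D : (N <= D * #|A|)%N ->
  exists2 L : {set V}, (#|L| <= 2 * D ^ 2)%N &
   forall x, (forall l, l \in L -> dot l x = 0) -> (N ^ 3 <= 2 * D ^ 4 * #|reps A x|)%N.
Proof.
move=> ND; have N0 : (0 < N)%N by rewrite expn_gt0 prime_gt0.
have A0 : (0 < #|A|)%N by rewrite lt0n; apply: contraTneq ND => ->; rewrite muln0 -ltnNge.
exists K.
  rewrite -(@leq_pmul2r (#|A| ^ 2)) ?expn_gt0 ?A0 //; apply: leq_trans cardK _.
  by rewrite -mulnA -expnMn leq_mul2l leq_exp2r.
move=> x /rep_large h; rewrite -(leq_pmul2l N0) -expnS.
apply: (@leq_trans (D ^ 4 * #|A| ^ 4)); first by rewrite -expnMn leq_exp2r.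
by apply: leq_trans (leq_mul (leqnn _) h) _; rewrite eq_leq //; move: (D ^ 4)%N => u; lia.
Qed.
End Bogolyubov.

(** * Solutions of additive equations *)

Lemma card_triples (T1 T2 T3 : finType) (P : T1 -> T2 -> T3 -> bool) :
  #|[set q : T1 * T2 * T3 | P q.1.1 q.1.2 q.2]| = (\sum_x \sum_y \sum_z P x y z)%N.
Proof.
rewrite (card_pairs (fun u z => P u.1 u.2 z)).
rewrite (pair_big xpredT xpredT (fun x y => \sum_z P x y z)%N) /=.
apply: eq_bigr => -[x y] _ /=.
rewrite -sum1_card big_mkcond /=; apply: eq_bigr => z _; rewrite inE.
by case: (P x y z).
Qed.

Lemma card_cover (T I : finType) (S : {set T}) (Q : I -> {set T}) :
  (forall x, x \in S -> exists i, x \in Q i) -> (#|S| <= \sum_i #|Q i|)%N.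
Proof.
move=> SQ; rewrite -sum1_card.
apply: (@leq_trans (\sum_(x in S) \sum_i (x \in Q i))).
  by apply: leq_sum => x /SQ[i xi]; rewrite (bigD1 i) //= xi.
rewrite exchange_big /=; apply: leq_sum => i _.
rewrite -[leqRHS]sum1_card big_mkcond [leqRHS]big_mkcond /=.
by apply: leq_sum => x _; case: (x \in S); case: (x \in Q i).
Qed.

Lemma sum_card_fibre2 (T U : finType) (B : {set T}) (phi : T -> U) :
  (\sum_u #|[set y in B | phi y == u]| ^ 2)%N =
  #|[set z : T * T | [&& z.1 \in B, z.2 \in B & phi z.1 == phi z.2]]|.
Proof.
rewrite (card_pairs (fun x y => [&& x \in B, y \in B & phi x == phi y])).
transitivity (\sum_u \sum_(x in B | phi x == u) #|[set y in B | phi y == u]|)%N.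
  apply: eq_bigr => u _; rewrite sum_nat_const -mulnn; congr (_ * _)%N.
  by apply: eq_card => x; rewrite !inE.
rewrite (exchange_big_dep (mem B)) /=; last by move=> u x _ /andP[].
rewrite big_mkcond /=; apply: eq_bigr => x _; case: ifP => xB; last first.
  by apply/esym/eq_card0 => y; rewrite inE.
rewrite (big_pred1 (phi x)) => [|u]; last by rewrite /= xB eq_sym.
by apply: eq_card => y; rewrite !inE [in RHS]eq_sym.
Qed.

Lemma energy_le (G : finZmodType) (A : {set G}) : (energy A <= #|A| ^ 3)%N.
Proof.
rewrite (expnS _ 2) -sum_diffrepT big_distrr; apply: leq_sum => x _ /=.
by rewrite -mulnn leq_mul2r diffrep_le orbT.
Qed.

Section Counting.
Variables (p : nat) (p_prime : prime p) (n : nat).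
Let F := 'F_p.
Let V := 'rV[F]_n.
Let N := (p ^ n)%N.

Let card_VE : #|{: V}| = N.
Proof. exact: card_rVp. Qed.

Let card_VV : #|{: V * V}| = (N ^ 2)%N.
Proof. by rewrite card_prod card_VE mulnn. Qed.

Lemma graph_mem (B : {set V}) (g : V -> V) y v :
  (row_mx y v \in graph B g) = (y \in B) && (v == g y).
Proof.
apply/imsetP/andP => [[z zB /eq_row_mx[-> ->]]|[yB /eqP->]]; first by rewrite zB.
by exists y.
Qed.

(** The equation g1 y1 + g2 y2 = h (y1 + y2) y3 is rare as soon as the graph of
    g1 on B has small energy, whatever g2 and h are.  With s = y1 + y2, two
    applications of Cauchy-Schwarz bound the count by quadruples satisfying
    g1 y + g2 (s - y) = g1 y' + g2 (s - y'), which say that the difference of two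
    graph points of g1 equals a difference of two graph points of g2.  In this
    form the result holds for each single pair (y, w) of the final argument and
    not only on average. *)
Lemma few_low_energy_solutions (B : {set V}) (g1 g2 : V -> V) (h : V -> V -> V) k :
  (k ^ 4 * energy (graph B g1) < N ^ 3)%N ->
  (k * #|[set q : V * V * V | (q.1.1 \in B) &&
         (g1 q.1.1 + g2 q.1.2 == h (q.1.1 + q.1.2) q.2)%R]| < N ^ 3)%N.
Proof.
move=> low.
pose m s t := #|[set y in B | g1 y + g2 (s - y) == t]|.
(* The chain of bounds is X^2 <= N^3 J and J^2 <= E N^3 for the energy E, so that
   X^4 <= N^9 E. *)
pose J := (\sum_s \sum_t m s t ^ 2)%N.
set X := #|_|.
have XE : X = (\sum_(z : V * V) 1 * m z.1 (h z.1 z.2))%N.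
  rewrite /X (card_triples (fun x y z => (x \in B) && (g1 x + g2 y == h (x + y) z))).
  transitivity (\sum_s \sum_y3 m s (h s y3))%N; last first.
    by rewrite pair_big /=; apply: eq_bigr => z _; rewrite mul1n.
  transitivity (\sum_x \sum_s \sum_z ((x \in B) && (g1 x + g2 (s - x) == h s z)%R))%N.
    apply: eq_bigr => x _.
    rewrite (reindex_inj (addIr (- x))) /=; apply: eq_bigr => s _.
    by rewrite [x + (s - x)]addrC subrK.
  rewrite exchange_big /=; apply: eq_bigr => s _.
  rewrite exchange_big /=; apply: eq_bigr => z _.
  rewrite /m -sum1_card [RHS]big_mkcond /=; apply: eq_bigr => x _; rewrite inE.
  by case: (_ && _).
have X2 : (X ^ 2 <= N ^ 3 * J)%N.
  have := Cauchy_Schwarz_nat xpredT (fun=> 1%N) (fun z : V * V => m z.1 (h z.1 z.2)).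
  rewrite sum_nat_const muln1 card_VV.
  rewrite -XE => /leq_trans; apply.
  rewrite (expnSr N 2) -mulnA leq_mul2l; apply/orP; right.
  rewrite -(pair_big xpredT xpredT (fun x y => m x (h x y) ^ 2)%N) /=.
  rewrite exchange_big -card_VE -sum1_card big_distrl /=.
  apply: leq_sum => y3 _; rewrite mul1n; apply: leq_sum => s _.
  by rewrite (bigD1 (h s y3)) //= leq_addr.
have JE : (J <= \sum_u diffrep (graph B g1) u * diffrep (graph [set: V] g2) u)%N.
  rewrite /J; under eq_bigr => s _ do rewrite /m (sum_card_fibre2 B (fun y => g1 y + g2 (s - y))).
  pose R (s : V) (z : V * V) := [&& z.1 \in B, z.2 \in B & g1 z.1 + g2 (s - z.1) == g1 z.2 + g2 (s - z.2)].
  rewrite -(card_pairs R).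
  pose D1 (u b : 'rV[F]_(n + n)) := (b \in graph B g1) && (b + u \in graph B g1).
  pose D2 (u b : 'rV[F]_(n + n)) := (b \in graph setT g2) && (b + u \in graph setT g2).
  rewrite [leqRHS](_ : _ = #|[set z : 'rV[F]_(n + n) * ('rV[F]_(n + n) * 'rV[F]_(n + n)) |
     D1 z.1 z.2.1 && D2 z.1 z.2.2]|); last first.
    rewrite (card_pairs (fun u bc => D1 u bc.1 && D2 u bc.2)).
    apply: eq_bigr => u _; rewrite /diffrep -cardsX; apply: eq_card => -[b c].
    by rewrite !inE.
  pose f (w : V * (V * V)) :=
    (row_mx (w.2.1 - w.2.2) (g1 w.2.1 - g1 w.2.2),
      (row_mx w.2.2 (g1 w.2.2), row_mx (w.1 - w.2.1) (g2 (w.1 - w.2.1)))).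
  rewrite -(card_imset _ (f := f)); last first.
    move=> [s [y y']] [s1 [y1 y1']] [/eq_row_mx[e1 _] /eq_row_mx[e2 _] /eq_row_mx[e3 _]].
    rewrite /= in e1 e2 e3.
    by move: e1 e3; rewrite e2 => /addIr-> /addIr->.
  apply/subset_leq_card/subsetP => _ /imsetP[[s [y y']] + ->].
  rewrite !inE /R /= => /and3P[yB y'B /eqP e].
  rewrite /D1 /D2 !add_row_mx !graph_mem /= !inE y'B eqxx /=.
  rewrite addrC subrK yB addrC subrK eqxx /=.
  have -> : s - y + (y - y') = s - y' by rewrite addrA subrK.
  rewrite eqxx /= addrC -(inj_eq (addrI (g1 y'))) -e addrA.
  by rewrite [g1 y' + _]addrC subrK.
have J2 : (J ^ 2 <= energy (graph B g1) * N ^ 3)%N.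
  apply: (@leq_trans ((\sum_u diffrep (graph B g1) u * diffrep (graph [set: V] g2) u) ^ 2)).
    by rewrite leq_exp2r.
  have := Cauchy_Schwarz_nat xpredT (diffrep (graph B g1)) (diffrep (graph [set: V] g2)).
  move=> /leq_trans; apply; rewrite leq_mul2l; apply/orP; right.
  by apply: leq_trans (energy_le _) _; rewrite card_graph cardsT card_VE.
have N0 : (0 < N)%N by rewrite expn_gt0 prime_gt0.
rewrite -(@ltn_exp2r _ _ 4) // expnMn.
apply: (@leq_ltn_trans (k ^ 4 * (N ^ 9 * energy (graph B g1)))).
  rewrite leq_mul2l; apply/orP; right.
  rewrite (expnM X 2 2); apply: (@leq_trans ((N ^ 3 * J) ^ 2)); first by rewrite leq_exp2r.
  rewrite expnMn -expnM; apply: leq_trans (leq_mul (leqnn _) J2) _.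
  by rewrite mulnCA -expnD mulnC.
rewrite mulnCA -expnM (expnD N 9 3) ltn_pmul2l // expn_gt0 N0 //.
Qed.

Lemma card_linear_fibre m (X : 'M[F]_(n, m)) v :
  (p ^ \rank X * #|[set y : V | y *m X == v]| <= N)%N.
Proof.
have [->|[y0]] := set_0Vmem [set y : V | y *m X == v]; first by rewrite cards0 muln0.
rewrite inE => /eqP y0v.
have : (#|[set y : V | y *m X == v]| <= p ^ (n - \rank X))%N.
  rewrite -mxrank_ker -(card_rowspace p_prime).
  rewrite -(card_imset _ (f := fun y => y - y0)); last exact: addIr.
  apply/subset_leq_card/subsetP => _ /imsetP[y + ->].
  rewrite !inE => /eqP yv; apply/sub_kermxP.
  by rewrite mulmxBl yv y0v subrr.
move=> h; apply: leq_trans (leq_mul (leqnn _) h) _.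
by rewrite -expnD subnKC // rank_leq_row.
Qed.

(** Membership of w in the space S_y of the introductory comment. *)
Definition structured (M : 'M[F]_n) (Phi : {vspace 'M[F]_n}) (y w : V) :=
  [exists C in Phi, (w - y *m C <= M)%MS].

Definition regular t (M : 'M[F]_n) (Phi : {vspace 'M[F]_n}) :=
  forall C, C \in Phi -> C != 0 -> (t <= \rank (C *m cokermx M))%N.

(** After substitution of the fourth term, the equation is linear in y1, y2, y3
    with coefficients C1 + C4, C2 + C4 and C3 - C4 modulo M.  If one of them is
    nonzero it has rank at least t; if all vanish the equation says that w is
    structured. *)
Lemma few_structured t M Phi y w C1 C2 C3 C4 : regular t M Phi ->
  ~~ structured M Phi y w ->
  C1 \in Phi -> C2 \in Phi -> C3 \in Phi -> C4 \in Phi ->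
  (p ^ t * #|[set q : V * V * V | ((w - (q.1.1 *m C1 + q.1.2 *m C2 + q.2 *m C3
    + (q.1.1 + q.1.2 - q.2 - y) *m C4))%R <= M)%MS]| <= N ^ 3)%N.
Proof.
move=> reg nw C1T C2T C3T C4T.
have key (C : 'M_n) (v : V) : C \in Phi -> C != 0 ->
    (p ^ t * \sum_x ((v - x *m C)%R <= M)%MS <= N)%N.
  move=> CT C0; apply: leq_trans (card_linear_fibre (C *m cokermx M) (v *m cokermx M)).
  apply: leq_mul; first by rewrite leq_exp2l ?prime_gt1 // reg.
  rewrite -sum1_card [leqRHS]big_mkcond /=; apply: leq_sum => x _.
  rewrite inE submxE mulmxBl -(mulmxA x) subr_eq0 eq_sym.
  by case: eqP.
pose P (x1 x2 x3 : V) := (w - (x1 *m C1 + x2 *m C2 + x3 *m C3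
    + (x1 + x2 - x3 - y) *m C4) <= M)%MS.
have two (f : V -> V -> nat) : (forall a b, p ^ t * f a b <= N)%N ->
    (p ^ t * \sum_a \sum_b f a b <= N ^ 3)%N.
  move=> le; rewrite big_distrr /=; apply: (@leq_trans (\sum_(a : V) N ^ 2)%N); last first.
    by rewrite sum_nat_const card_VE -expnS.
  apply: leq_sum => a _; rewrite big_distrr /=; apply: (@leq_trans (\sum_(b : V) N)%N).
    by apply: leq_sum.
  by rewrite sum_nat_const card_VE mulnn.
rewrite (card_triples P).
have [e1|n1] := eqVneq (C1 + C4) 0; last first.
  rewrite exchange_big /=; under eq_bigr do rewrite exchange_big /=.
  apply: two => x2 x3; apply: leq_trans (key _ (w - (x2 *m C2 + x3 *m C3 + (x2 - x3 - y) *m C4)) _ n1).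
    rewrite leq_mul2l leq_sum ?orbT // => x1 _; rewrite /P -(addrA x1) -(addrA x1) mulmxDl.
    by rewrite -[x1 *m C1 + _ + _]addrA addrACA -mulmxDr [X in w - X]addrC opprD addrA.
  exact: memvD.
have [e2|n2] := eqVneq (C2 + C4) 0; last first.
  under eq_bigr do rewrite exchange_big /=.
  apply: two => x1 x3; apply: leq_trans (key _ (w - (x1 *m C1 + x3 *m C3 + (x1 - x3 - y) *m C4)) _ n2).
    rewrite leq_mul2l leq_sum ?orbT // => x2 _; rewrite /P (addrC x1) -(addrA x2) -(addrA x2) mulmxDl.
    rewrite [x1 *m C1 + _]addrC -[x2 *m C2 + _ + _]addrA addrACA -mulmxDr.
    by rewrite [X in w - X]addrC opprD addrA.
  exact: memvD.
have [e3|n3] := eqVneq (C3 - C4) 0; last first.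
  apply: two => x1 x2; apply: leq_trans (key _ (w - (x1 *m C1 + x2 *m C2 + (x1 + x2 - y) *m C4)) _ n3).
    rewrite leq_mul2l leq_sum ?orbT // => x3 _; rewrite /P (addrAC _ (- x3)) [_ - x3]addrC mulmxDl.
    rewrite [_ + x3 *m C3]addrC addrACA mulNmx -mulmxBr.
    by rewrite [X in w - X]addrC opprD addrA.
  exact: rpredB.
rewrite big1 ?muln0 // => x1 _; rewrite big1 // => x2 _; rewrite big1 // => x3 _.
rewrite (_ : P x1 x2 x3 = false) //; apply: contraNF nw; rewrite /P => h.
apply/exists_inP; exists (- C4); first by rewrite rpredN.
move: h; congr (_ - _ <= M)%MS.
move/eqP: e1; rewrite addr_eq0 => /eqP->; move/eqP: e2; rewrite addr_eq0 => /eqP->.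
move/eqP: e3; rewrite subr_eq0 => /eqP->.
have -> : x1 *m - C4 + x2 *m - C4 + x3 *m C4 = - ((x1 + x2 - x3) *m C4).
  by rewrite mulmxBl mulmxDl !mulmxN opprB opprD addrC.
by rewrite (mulmxBl (x1 + x2 - x3) y) addKr mulmxN.
Qed.
End Counting.

(** * Structured and generic directions *)

Lemma card_cover2 (T I J : finType) (S : {set T}) (Q : I -> {set T}) (R : J -> {set T}) :
  (forall x, x \in S -> (exists i, x \in Q i) \/ (exists j, x \in R j)) ->
  (#|S| <= \sum_i #|Q i| + \sum_j #|R j|)%N.
Proof.
move=> SQR; pose S1 := [set x in S | [exists i, x \in Q i]].
rewrite -(cardsID S1 S) leq_add // card_cover // => x.
  by rewrite !inE => /andP[_ /andP[_ /existsP[i xi]]]; exists i.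
rewrite !inE => /andP[+ xS]; rewrite xS /= => nQ.
by case: (SQR x xS) => // -[i xi]; case/existsP: nQ; exists i.
Qed.

Section Structure.
Variables (p : nat) (p_prime : prime p) (n d : nat).
Let F := 'F_p.
Let V := 'rV[F]_n.
Let N := (p ^ n)%N.
Variables (frame : V -> 'M[F]_(d, n)) (Y : {set V}).

Implicit Types (M : 'M[F]_n) (Phi : {vspace 'M[F]_n}) (y w : V).

(** The matrix [frame y] is the F(y) of the introductory comment, so this is a
    generic element of U_y. *)
Definition row_comb (a : 'rV[F]_d) (y : V) : V := a *m frame y.

Definition unstructured (M : 'M[F]_n) (Phi : {vspace 'M[F]_n}) (a : 'rV[F]_d) : {set V} :=
  [set y in Y | ~~ structured M Phi y (row_comb a y)].

Definition reps_span (y : V) (q : V * V * V) : 'M[F]_n :=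
  (frame q.1.1 + frame q.1.2 + frame q.2 + frame (q.1.1 + q.1.2 - q.2 - y)%R)%MS.

(** No coefficient row hides further additive structure outside the spaces S_y. *)
Definition exhausted k M Phi :=
  forall a, (k ^ 4 * energy (graph (unstructured M Phi a) (row_comb a)) < N ^ 3)%N.

Lemma card_vspace_mx (Phi : {vspace 'M[F]_n}) : #|[set C | C \in Phi]| = (p ^ \dim Phi)%N.
Proof.
transitivity (#|F| ^ \dim Phi)%N; last by congr (_ ^ _)%N; apply: card_Fp.
by rewrite -card_vspace; apply: eq_card => C; rewrite inE.
Qed.

Let card_rV_d m : #|{: 'rV[F]_m}| = (p ^ m)%N.
Proof. exact: card_rVp. Qed.

(** If w = a1 F(y1) + ... + a4 F(y4), then either some term leaves S_(y_i), and
    [few_low_energy_solutions] applies after moving that term to the first place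
    (for the last two terms, by exchanging y and - y), or all terms are
    structured and [few_structured] applies.  The factors p^(4d) and
    p^(4 dim Phi) count the choices of the a_i and of the maps in Phi. *)
Lemma few_reps_through k t M Phi y w : regular t M Phi -> exhausted k M Phi ->
  ~~ structured M Phi y w ->
  (k * p ^ t * #|[set q in reps Y y | (w <= reps_span y q)%MS]| <=
   (4 * p ^ (4 * d) * p ^ t + p ^ (4 * \dim Phi) * k) * N ^ 3)%N.
Proof.
move=> reg exh nw.
pose A4 := (('rV[F]_d * 'rV[F]_d) * ('rV[F]_d * 'rV[F]_d))%type.
pose M4 := (('M[F]_n * 'M[F]_n) * ('M[F]_n * 'M[F]_n))%type.
pose y4 (q : V * V * V) := q.1.1 + q.1.2 - q.2 - y.
pose eqw (a : A4) (q : V * V * V) :=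
  row_comb a.1.1 q.1.1 + row_comb a.1.2 q.1.2 + row_comb a.2.1 q.2 + row_comb a.2.2 (y4 q) == w.
pose S1 (a : A4) := [set q | (q.1.1 \in unstructured M Phi a.1.1) && eqw a q].
pose S2 (a : A4) := [set q : V * V * V | (q.1.2 \in unstructured M Phi a.1.2) && eqw a q].
pose S3 (a : A4) := [set q : V * V * V | (q.2 \in unstructured M Phi a.2.1) && eqw a q].
pose S4 (a : A4) := [set q : V * V * V | (y4 q \in unstructured M Phi a.2.2) && eqw a q].
pose Phi_set := [set C | C \in Phi].
pose Phi4 := setX (setX Phi_set Phi_set) (setX Phi_set Phi_set).
pose S5 (C : M4) := if C \in Phi4 then [set q : V * V * V |
  (w - (q.1.1 *m C.1.1 + q.1.2 *m C.1.2 + q.2 *m C.2.1 + y4 q *m C.2.2) <= M)%MS] else set0.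
have move_set (S : {set V * V * V}) (s : V * V * V -> V * V * V) B g1 g2 h :
    injective s -> (k ^ 4 * energy (graph B g1) < N ^ 3)%N ->
    (forall q, q \in S -> ((s q).1.1 \in B) &&
       (g1 (s q).1.1 + g2 (s q).1.2 == h ((s q).1.1 + (s q).1.2) (s q).2)) ->
    (k * #|S| <= N ^ 3)%N.
  move=> s_inj low sP; apply: leq_trans (ltnW (few_low_energy_solutions p_prime g2 h low)).
  rewrite leq_mul2l -(card_imset (mem S) s_inj); apply/orP; right.
  by apply/subset_leq_card/subsetP => _ /imsetP[q qS ->]; rewrite inE sP.
have l1 a : (k * #|S1 a| <= N ^ 3)%N.
  apply: (move_set _ id _ (row_comb a.1.1) (row_comb a.1.2)
    (fun s z => w - row_comb a.2.1 z - row_comb a.2.2 (s - z - y))); [by move=> ?| exact: exh |].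
  move=> q; rewrite inE => /andP[-> /eqP e] /=.
  by rewrite -e addrAC -/(y4 q) addrK addrK.
have l2 a : (k * #|S2 a| <= N ^ 3)%N.
  apply: (move_set _ (fun q => (q.1.2, q.1.1, q.2)) _ (row_comb a.1.2) (row_comb a.1.1)
    (fun s z => w - row_comb a.2.1 z - row_comb a.2.2 (s - z - y))); [| exact: exh |].
    by move=> [[x1 x2] x3] [[z1 z2] z3] [-> -> ->].
  move=> q; rewrite inE => /andP[-> /eqP e] /=.
  by rewrite -e addrAC [q.1.2 + _]addrC -/(y4 q) addrK addrK addrC.
have y4E q : y4 q + q.2 - q.1.1 + y = q.1.2.
  by rewrite /y4 (addrAC _ (- y) q.2) subrK addrAC subrK addrC addKr.
have l3 a : (k * #|S3 a| <= N ^ 3)%N.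
  apply: (move_set _ (fun q => (q.2, y4 q, q.1.1)) _ (row_comb a.2.1) (row_comb a.2.2)
    (fun s z => w - row_comb a.1.1 z - row_comb a.1.2 (s - z + y))); [| exact: exh |].
    move=> [[x1 x2] x3] [[z1 z2] z3] []; rewrite /y4 /= => -> + e1; rewrite e1.
    by move=> /addIr/addIr/addrI->.
  move=> q; rewrite inE => /andP[-> /eqP e] /=.
  have -> : q.2 + y4 q - q.1.1 + y = q.1.2.
    by rewrite [q.2 + _]addrC y4E.
  by apply/eqP; rewrite -e -[X in X - _ - _]addrA -[RHS]addrA -opprD [RHS]addrC addKr.
have l4 a : (k * #|S4 a| <= N ^ 3)%N.
  apply: (move_set _ (fun q => (y4 q, q.2, q.1.1)) _ (row_comb a.2.2) (row_comb a.2.1)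
    (fun s z => w - row_comb a.1.1 z - row_comb a.1.2 (s - z + y))); [| exact: exh |].
    move=> [[x1 x2] x3] [[z1 z2] z3] [+ e3 e1]; rewrite /y4 /= e3 e1.
    by move=> /addIr/addIr/addrI->.
  move=> q; rewrite inE => /andP[-> /eqP e] /=.
  have -> : y4 q + q.2 - q.1.1 + y = q.1.2.
    exact: y4E.
  rewrite -e [row_comb a.2.2 _ + _]addrC.
  by apply/eqP; rewrite -[X in X - _ - _]addrA -[RHS]addrA -opprD [RHS]addrC addKr.
have l5 C : (p ^ t * #|S5 C| <= (C \in Phi4) * N ^ 3)%N.
  rewrite /S5; case: ifP => [|_]; last by rewrite cards0 muln0.
  case: C => [[C1 C2] [C3 C4]]; rewrite !inE /= => /andP[/andP[h1 h2] /andP[h3 h4]].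
  by rewrite mul1n; apply: (few_structured p_prime reg nw).
pose SS a := S1 a :|: S2 a :|: S3 a :|: S4 a.
have lSS a : (k * #|SS a| <= 4 * N ^ 3)%N.
  have hU (A B : {set V * V * V}) : (#|A :|: B| <= #|A| + #|B|)%N by apply: leq_card_setU.
  apply: (@leq_trans (k * (#|S1 a| + #|S2 a| + #|S3 a| + #|S4 a|))).
    rewrite leq_mul2l; apply/orP; right; apply: leq_trans (hU _ _) _; rewrite leq_add2r.
    by apply: leq_trans (hU _ _) _; rewrite leq_add2r.
  rewrite !mulnDr -[4%N]/(1 + 1 + 1 + 1)%N !mulnDl !mul1n.
  exact: leq_add (leq_add (leq_add (l1 a) (l2 a)) (l3 a)) (l4 a).
set bad := [set q in _ | _].
have cover q : q \in bad -> (exists a, q \in SS a) \/ (exists C, q \in S5 C).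
  rewrite inE => /andP[]; rewrite inE => /and4P[Y1 Y2 Y3 Y4].
  move=> /sub_addsmxP[[u1 a4] /= wE].
  have /sub_addsmxP[[u2 a3] /= u1E] := submxMl u1 (frame q.1.1 + frame q.1.2 + frame q.2)%MS.
  have /sub_addsmxP[[a1 a2] /= u2E] := submxMl u2 (frame q.1.1 + frame q.1.2)%MS.
  pose a : A4 := ((a1, a2), (a3, a4)).
  have aw : eqw a q by rewrite /eqw wE u1E u2E.
  have [s1|n1] := boolP (structured M Phi q.1.1 (row_comb a1 q.1.1)); last first.
    left; exists a; apply/setUP; left; apply/setUP; left; apply/setUP; left.
    by rewrite inE aw inE Y1 n1.
  have [s2|n2] := boolP (structured M Phi q.1.2 (row_comb a2 q.1.2)); last first.
    left; exists a; apply/setUP; left; apply/setUP; left; apply/setUP; right.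
    by rewrite inE aw inE Y2 n2.
  have [s3|n3] := boolP (structured M Phi q.2 (row_comb a3 q.2)); last first.
    left; exists a; apply/setUP; left; apply/setUP; right.
    by rewrite inE aw inE Y3 n3.
  have [s4|n4] := boolP (structured M Phi (y4 q) (row_comb a4 (y4 q))); last first.
    left; exists a; apply/setUP; right.
    by rewrite inE aw inE Y4 n4.
  move: s1 s2 s3 s4 => /exists_inP[C1 T1 h1] /exists_inP[C2 T2 h2] /exists_inP[C3 T3 h3] /exists_inP[C4 T4 h4].
  right; exists ((C1, C2), (C3, C4)); rewrite /S5 !inE /= T1 T2 T3 T4 /= inE /=.
  rewrite -(eqP aw) /= !opprD.
  rewrite (addrACA _ _ (- _ - _ - _)) (addrACA _ _ (- _ - _)) (addrACA (row_comb a1 _)).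
  by apply: addmx_sub => //; apply: addmx_sub => //; apply: addmx_sub.
have le := card_cover2 cover.
have sum4 : (k * \sum_a #|SS a| <= p ^ (4 * d) * (4 * N ^ 3))%N.
  rewrite big_distrr /=; apply: (@leq_trans (\sum_(a : A4) 4 * N ^ 3)%N).
    by apply: leq_sum.
  rewrite sum_nat_const leq_mul2r !card_prod card_rV_d -!expnD !addnn -!mul2n mulnA.
  by rewrite leqnn orbT.
have sum5 : (p ^ t * \sum_C #|S5 C| <= p ^ (4 * \dim Phi) * N ^ 3)%N.
  rewrite big_distrr /=; apply: (@leq_trans (\sum_(C : M4) (C \in Phi4) * N ^ 3)%N).
    by apply: leq_sum.
  rewrite -big_distrl leq_mul2r /=; apply/orP; right.
  rewrite -big_mkcond sum1_card !cardsX card_vspace_mx -!expnD !addnn -!mul2n.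
  by rewrite mulnA.
move: le sum4 sum5; move: #|bad| (\sum_a #|SS a|)%N (\sum_C #|S5 C|)%N.
move: (p ^ (4 * d))%N (p ^ (4 * \dim Phi))%N (N ^ 3)%N (p ^ t)%N.
move=> P4 Pr N3 pt bd s4 s5 le h4 h5.
apply: (@leq_trans (k * pt * (s4 + s5))); first by rewrite leq_mul2l le orbT.
have := leq_mul (leqnn k) h5; have := leq_mul (leqnn pt) h4; lia.
Qed.

(** Any representation may serve as q': its span has at most p^(4d) elements, and
    those outside S_y together exclude only a small part of the representations
    of y. *)
Lemma generic_pair b k t r M Phi y : regular t M Phi -> exhausted k M Phi ->
  (N ^ 3 <= b * #|reps Y y|)%N -> (0 < k)%N -> (8 * p ^ (8 * d) * b <= k)%N ->
  (\dim Phi <= r)%N -> (4 * p ^ (4 * d + 4 * r) * b <= p ^ t)%N ->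
  exists q q', [/\ q \in reps Y y, q' \in reps Y y &
    forall w : V, (w <= reps_span y q)%MS -> (w <= reps_span y q')%MS -> structured M Phi y w].
Proof.
move=> reg exh many k0 kl dr tl.
have N0 : (0 < N ^ 3)%N by rewrite !expn_gt0 prime_gt0.
have /set0Pn[q' q'r] : reps Y y != set0.
  by apply: contraTneq many => ->; rewrite cards0 muln0 -ltnNge.
pose W := [set w : V | (w <= reps_span y q')%MS && ~~ structured M Phi y w].
have cW : (#|W| <= p ^ (4 * d))%N.
  apply: (@leq_trans (p ^ \rank (reps_span y q'))).
    rewrite -(card_rowspace p_prime); apply/subset_leq_card/subsetP => w.
    by rewrite !inE => /andP[].
  rewrite leq_exp2l ?prime_gt1 // /reps_span.
  have hU m1 m2 (A : 'M[F]_(m1, n)) (B : 'M[F]_(m2, n)) :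
    (\rank (A + B)%MS <= \rank A + \rank B)%N := mxrank_adds_leqif A B.
  have h q := rank_leq_row (frame q).
  rewrite -[4%N]/(1 + 1 + 1 + 1)%N !mulnDl !mul1n.
  do 3![apply: leq_trans (hU _ _ _ _) _; apply: leq_add; last exact: h].
  exact: h.
have [/exists_inP[q qr /forall_inP qP]|none] :=
  boolP [exists q in reps Y y, forall w in W, ~~ (w <= reps_span y q)%MS].
  exists q, q'; split => // w wq wq'; apply: contraLR wq => nw.
  by apply: qP; rewrite inE wq'.
pose Q w := if w \in W then [set q in reps Y y | (w <= reps_span y q)%MS] else set0.
have cover q : q \in reps Y y -> exists w, q \in Q w.
  move=> qr; have /forall_inPn[w wW /negPn wq] : ~~ [forall w in W, ~~ (w <= reps_span y q)%MS].
    by apply: contra none => h; apply/exists_inP; exists q.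
  by exists w; rewrite /Q wW inE qr.
have le := card_cover cover.
have : (k * p ^ t * #|reps Y y| <=
   p ^ (4 * d) * ((4 * p ^ (4 * d) * p ^ t + p ^ (4 * r) * k) * N ^ 3))%N.
  apply: leq_trans (leq_mul (leqnn _) le) _; rewrite big_distrr /=.
  apply: (@leq_trans (\sum_(w in W) ((4 * p ^ (4 * d) * p ^ t + p ^ (4 * r) * k) * N ^ 3))%N); last first.
    by rewrite sum_nat_const leq_mul2r cW orbT.
  rewrite [leqRHS]big_mkcond /=; apply: leq_sum => w _; rewrite /Q.
  case: ifP => [|_]; last by rewrite cards0 muln0.
  rewrite inE => /andP[_ nw]; apply: leq_trans (few_reps_through reg exh nw) _.
  rewrite leq_mul2r leq_add2l leq_mul2r leq_exp2l ?prime_gt1 // leq_mul2l dr.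
  by rewrite !orbT.
have pt0 : (0 < p ^ t)%N by rewrite expn_gt0 prime_gt0.
have : (0 < k * p ^ t * N ^ 3)%N by rewrite muln_gt0 N0 andbT muln_gt0 k0.
move: many kl tl; rewrite (_ : 8 * d = 4 * d + 4 * d)%N; last by lia.
rewrite !expnD; move: (p ^ (4 * d))%N (p ^ (4 * r))%N (N ^ 3)%N (p ^ t)%N #|reps Y y|.
move=> P Pr N3 pt R many kl tl pos up.
have h1 := leq_mul (leqnn (k * pt)) many.
have h2 := leq_mul (leqnn b) up.
have h3 := leq_mul (leqnn (pt * N3)) kl.
have h4 := leq_mul (leqnn (k * N3)) tl.
exfalso; move: pos h1 h2 h3 h4; clear.
set x := (k * pt * N3)%N.
lia.
Qed.

Lemma structured_mono M M' Phi Phi' :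
  (M <= M')%MS -> (Phi <= Phi')%VS -> forall y w, structured M Phi y w -> structured M' Phi' y w.
Proof.
move=> MM sPhi y w /exists_inP[C CT h]; apply/exists_inP; exists C.
  exact: (subvP sPhi).
exact: submx_trans MM.
Qed.

Lemma unstructured_mono M M' Phi Phi' a :
  (forall y w, structured M Phi y w -> structured M' Phi' y w) ->
  unstructured M' Phi' a \subset unstructured M Phi a.
Proof.
move=> sub; apply/subsetP => y; rewrite !inE => /andP[-> /=].
by apply: contra; apply: sub.
Qed.

Lemma energyS (G : finZmodType) (A B : {set G}) : A \subset B -> (energy A <= energy B)%N.
Proof.
move=> /subsetP AB; apply: leq_sum => x _; rewrite leq_exp2r //.
by apply/subset_leq_card/subsetP => z; rewrite !inE => /andP[/AB-> /AB->].
Qed.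

Lemma exhausted_mono k M M' Phi Phi' :
  (forall y w, structured M Phi y w -> structured M' Phi' y w) ->
  exhausted k M Phi -> exhausted k M' Phi'.
Proof.
move=> sub exh a; apply: leq_ltn_trans (exh a); rewrite leq_mul2l energyS ?orbT //.
by apply: imsetS; apply: unstructured_mono.
Qed.

(** Each step adjoins an affine map that captures at least N / Z pairs (a, y) for
    which a F(y) was outside S_y; there are p^d N pairs in total. *)
Lemma exhaustion k Z g L : g = (4 * k ^ 4)%N -> L = (64 * g ^ 9)%N ->
  Z = (4 * g ^ 2 * (p ^ (2 * g * L ^ 4) * L ^ 2))%N ->
  exists M Phi, [/\ exhausted k M Phi, (\rank M <= Z * p ^ d)%N & (\dim Phi <= Z * p ^ d)%N].
Proof.
move=> gE LE ZE.
have N0 : (0 < N)%N by rewrite expn_gt0 prime_gt0.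
(* The invariant r N + Z * (number of uncaptured pairs) <= Z p^d N bounds the
   number r of steps made so far; m only serves for the induction. *)
suff main m : forall r M Phi, (\sum_a #|unstructured M Phi a| <= m)%N ->
    (\rank M <= r)%N -> (\dim Phi <= r)%N ->
    (r * N + Z * \sum_a #|unstructured M Phi a| <= Z * p ^ d * N)%N ->
    exists M Phi, [/\ exhausted k M Phi, (\rank M <= Z * p ^ d)%N & (\dim Phi <= Z * p ^ d)%N].
  apply: (main _ 0%N 0 0%VS (leqnn _)); rewrite ?mxrank0 ?dimv0 //.
  rewrite mul0n add0n -mulnA leq_mul2l; apply/orP; right.
  apply: (@leq_trans (\sum_(a : 'rV[F]_d) N)%N).
    by apply: leq_sum => a _; apply: leq_trans (max_card _) _; rewrite card_rV_d.
  by rewrite sum_nat_const card_rV_d.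
elim: m => [|m IH] r M Phi sm rM dT tot.
all: have [/forallP exh|] := boolP [forall a, (k ^ 4 * energy (graph (unstructured M Phi a) (row_comb a)) < N ^ 3)%N];
  first by exists M, Phi; split => //; [apply: leq_trans rM _|apply: leq_trans dT _];
    rewrite -(leq_pmul2r N0); apply: leq_trans tot; apply: leq_addr.
all: rewrite negb_forall => /existsP[a]; rewrite -leqNgt => big.
all: have [T [v agree]] := approximate_hom_affine p_prime gE LE big.
all: rewrite -ZE in agree; set E := [set y in _ | _] in agree.
all: have E0 : (0 < #|E|)%N by rewrite lt0n; apply: contraTneq agree => ->; rewrite muln0 -ltnNge.
  have : (#|E| <= \sum_a #|unstructured M Phi a|)%N.
    rewrite (bigD1 a) //=; apply: leq_trans (leq_addr _ _).
    by apply/subset_leq_card/subsetP => y; rewrite inE => /andP[].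
  by move=> h; move: (leq_trans E0 (leq_trans h sm)).
(* The constant term v of the affine map goes to M, its linear part T to Phi. *)
pose M' := (M + v)%MS; pose Phi' := (Phi + <[T]>)%VS.
have sub y w : structured M Phi y w -> structured M' Phi' y w.
  by apply: structured_mono; rewrite ?addsmxSl ?addvSl.
have drop : (\sum_a #|unstructured M' Phi' a| + #|E| <= \sum_a #|unstructured M Phi a|)%N.
  rewrite (bigD1 a) //= [leqRHS](bigD1 a) //= addnAC leq_add //; last first.
    by apply: leq_sum => a' _; apply/subset_leq_card/unstructured_mono.
  rewrite -cardsUI (_ : _ :&: E = set0) ?cards0 ?addn0.
    apply: subset_leq_card; rewrite subUset unstructured_mono //=.
    by apply/subsetP => y; rewrite inE => /andP[].
  apply/setP => y; rewrite !inE; apply/negP => /andP[/andP[_ /negP ns] /andP[_ /eqP e]].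
  apply: ns; apply/exists_inP; exists T; first by rewrite (subvP (addvSr _ _)) ?memv_line.
  by rewrite e addrC addKr addsmxSr.
apply: (IH r.+1 M' Phi').
- by rewrite -ltnS; apply: leq_trans sm; apply: leq_trans drop; rewrite -addn1 leq_add2l.
- apply: leq_trans (mxrank_adds_leqif _ _) _ => /=.
  by rewrite -(addn1 r) leq_add // rank_leq_row.
- apply: leq_trans (dimv_add_leqif _ _) _ => /=.
  by rewrite -(addn1 r) leq_add // dim_vline; case: (T != 0).
- apply: leq_trans tot; rewrite mulSn addnAC addnC leq_add2l.
  by apply: leq_trans (leq_add agree (leqnn _)) _; rewrite -mulnDr addnC leq_mul2l drop orbT.
Qed.

(** A nonzero C in Phi of rank less than t modulo M is removed from Phi after its
    image has been added to M; this enlarges each S_y and costs at most t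
    dimensions of M for one dimension of Phi. *)
Lemma regularize t M Phi : exists M' Phi',
  [/\ forall y w, structured M Phi y w -> structured M' Phi' y w, regular t M' Phi',
   (\rank M' <= \rank M + \dim Phi * t)%N & (\dim Phi' <= \dim Phi)%N].
Proof.
elim: {Phi}(\dim Phi) {-2}Phi (erefl (\dim Phi)) M => [|m IH] Phi dT M.
  exists M, Phi; split; rewrite ?leq_addr // => C.
  by move/eqP: dT; rewrite dimv_eq0 => /eqP->; rewrite memv0 => ->.
have [/exists_inP[C CT /andP[C0 small]]|reg] :=
  boolP [exists C in Phi, (C != 0) && (\rank (C *m cokermx M) < t)%N]; last first.
  exists M, Phi; split; rewrite ?dT ?leq_addr // => C CT C0.
  rewrite leqNgt; apply: contra reg => small; apply/exists_inP; exists C => //.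
  by rewrite C0.
pose M1 := (M + C)%MS; pose Phi1 := (Phi :\: <[C]>)%VS.
have dT1 : \dim Phi1 = m.
  have := dimv_cap_compl Phi <[C]>; rewrite dT (capv_idPr _) ?dim_vline ?C0 => [[]//|].
  by rewrite -memvE.
have rM1 : (\rank M1 <= \rank M + t)%N.
  rewrite -(leq_add2r (\rank (M :&: C)%MS)) /M1 mxrank_sum_cap.
  rewrite -(mxrank_mul_ker C (cokermx M)) -addnA leq_add2l leq_add // ?(ltnW small) //.
  apply: mxrankS; rewrite sub_capmx capmxSl andbT submxE.
  by rewrite -sub_kermx capmxSr.
have [M' [Phi' [sub reg rM' dT']]] := IH Phi1 dT1 M1.
exists M', Phi'; split => //.
- move=> y w /exists_inP[C' C'T h]; apply: sub.
  have : C' \in (Phi1 + Phi :&: <[C]>)%VS by rewrite addv_diff_cap.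
  case/memv_addP => C1 C1T [C2 /memv_capP[_ /vlineP[c C2E]] C'E].
  apply/exists_inP; exists C1 => //.
  have -> : w - y *m C1 = (w - y *m C') + c *: (y *m C).
    by rewrite C'E C2E mulmxDr opprD addrA scalemxAr subrK.
  rewrite addmx_sub ?(submx_trans h) ?addsmxSl // scalemx_sub //.
  by rewrite (submx_trans (submxMl _ _)) ?addsmxSr.
- by apply: leq_trans rM' _; rewrite dT1 dT mulSn addnA leq_add2r.
- by rewrite dT (leq_trans dT') // dT1.
Qed.
End Structure.

(** (U cap U')^perp = U^perp + U'^perp: one inclusion is clear and the dimensions
    agree. *)
Lemma annihilator_cap (F : fieldType) n (U U' : 'M[F]_n) (x : 'rV[F]_n) :
  (forall w : 'rV[F]_n, (w <= U)%MS -> (w <= U')%MS -> w *m x^T = 0) ->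
  exists x1 x2, [/\ x = x1 + x2, U *m x1^T = 0 & U' *m x2^T = 0].
Proof.
move=> perp.
have tr_ker m (A : 'M[F]_n) (B : 'M[F]_(m, n)) : (B <= kermx A^T)%MS = (A <= kermx B^T)%MS.
  rewrite !sub_kermx -(inj_eq trmx_inj) trmx_mul trmxK trmx0.
  by [].
have capx : (x <= kermx (U :&: U')^T)%MS.
  rewrite tr_ker; apply/row_subP => i; apply/sub_kermxP; apply: perp.
    by apply: submx_trans (row_sub _ _) (capmxSl _ _).
  by apply: submx_trans (row_sub _ _) (capmxSr _ _).
have kerS (A B : 'M[F]_n) : (A <= B)%MS -> (kermx B^T <= kermx A^T)%MS.
  by move=> AB; rewrite tr_ker (submx_trans AB) // -tr_ker.
have sumS : (kermx U^T + kermx U'^T <= kermx (U :&: U')^T)%MS.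
  by rewrite addsmx_sub !kerS ?capmxSl ?capmxSr.
have capS : (kermx U^T :&: kermx U'^T <= kermx (U + U')%MS^T)%MS.
  by rewrite tr_ker addsmx_sub; apply/andP; split; rewrite -tr_ker ?capmxSl ?capmxSr.
have : (kermx (U :&: U')^T <= kermx U^T + kermx U'^T)%MS.
  rewrite -(geq_leqif (mxrank_leqif_sup sumS)).
  have := mxrankS capS; have := mxrank_sum_cap (kermx U^T) (kermx U'^T).
  have := mxrank_sum_cap U U'; rewrite !mxrank_ker !mxrank_tr.
  have := rank_leq_row (U + U')%MS; have := rank_leq_row U; have := rank_leq_row U'.
  by have := mxrankS (addsmxSl U U'); have := mxrankS (addsmxSr U U'); lia.
move=> /(submx_trans capx)/sub_addsmxP[[u1 u2] /= xE].
exists (u1 *m kermx U^T), (u2 *m kermx U'^T); split => //.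
  by apply/sub_kermxP; rewrite -tr_ker submxMl.
by apply/sub_kermxP; rewrite -tr_ker submxMl.
Qed.

(** * The theorem in coordinates *)

Section Core.
Variables (p : nat) (p_prime : prime p) (n : nat).
Let F := 'F_p.
Let V := 'rV[F]_n.
Let N := (p ^ n)%N.

(** The fibres outside this set contain at most half of P. *)
Lemma dense_fibres D (P : {set V * V}) : (N ^ 2 <= D * #|P|)%N ->
  (N <= 2 * D * #|[set y : V | N <= 2 * D * #|[set x | (x, y) \in P]|]|)%N.
Proof.
move=> dense; set Y := [set y | _].
have N0 : (0 < N)%N by rewrite expn_gt0 prime_gt0.
have PE : #|P| = (\sum_(y in Y) #|[set x | (x, y) \in P]| +
                 \sum_(y | y \notin Y) #|[set x | (x, y) \in P]|)%N.
  rewrite -(bigID (mem Y) predT) /=.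
  rewrite -(card_pairs_swap (fun x y => (x, y) \in P)).
  by apply: eq_card => -[x y]; rewrite inE.
have hi : (\sum_(y in Y) #|[set x | (x, y) \in P]| <= #|Y| * N)%N.
  rewrite -sum_nat_const; apply: leq_sum => y _.
  by apply: leq_trans (max_card _) _; rewrite card_rVp.
have lo : (2 * D * \sum_(y | y \notin Y) #|[set x | (x, y) \in P]| <= N ^ 2)%N.
  rewrite big_distrr /=; apply: (@leq_trans (\sum_(y : V) N)%N); last first.
    by rewrite sum_nat_const card_rVp // mulnn.
  rewrite big_mkcond /=; apply: leq_sum => y _; case: ifP => //.
  by rewrite inE -ltnNge => /ltnW.
rewrite -(leq_pmul2r N0); have := leq_mul (leqnn (2 * D)) hi.
move: dense lo; rewrite PE -!mulnn => h1 h2 h3; move: h1 h2 h3.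
by move: (\sum_(y in Y) _)%N (\sum_(y | y \notin Y) _)%N => u v; lia.
Qed.

(** The parameters k and t are so large in terms of d, b and r that the exceptional
    representations counted by [few_reps_through], summed over the elements of
    U_q', are fewer than the N^3 / b representations of y. *)
Lemma bilinear_Bogolyubov_coord D d b k t g L Z r (P : {set V * V}) :
  d = (2 * (2 * D) ^ 2)%N -> b = (2 * (2 * D) ^ 4)%N ->
  g = (4 * k ^ 4)%N -> L = (64 * g ^ 9)%N ->
  Z = (4 * g ^ 2 * (p ^ (2 * g * L ^ 4) * L ^ 2))%N -> r = (Z * p ^ d)%N ->
  (0 < k)%N -> (8 * p ^ (8 * d) * b <= k)%N ->
  (4 * p ^ (4 * d + 4 * r) * b <= p ^ t)%N ->
  (N ^ 2 <= D * #|P|)%N ->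
  exists (M : 'M[F]_n) (Phi : {vspace 'M[F]_n}) (S : {set V}),
    [/\ (\rank M <= r + r * t)%N, (\dim Phi <= r)%N, (#|S| <= d)%N &
     forall x y : V, M *m x^T = 0 -> (forall l, l \in S -> dot l y = 0) ->
       (forall C, C \in Phi -> dot (y *m C) x = 0) ->
       (x, y) \in phiH (phiV (phiH P))].
Proof.
move=> dE bE gE LE ZE rE k0 kl tl dense.
have N0 : (0 < N)%N by rewrite expn_gt0 prime_gt0.
pose fib y := [set x | (x, y) \in P].
pose Y := [set y : V | (N <= 2 * D * #|fib y|)%N].
have [S Ssmall Srep] := Bogolyubov p_prime (dense_fibres dense).
rewrite -/fib -/Y -bE -dE in Ssmall Srep.
have /fin_all_exists[K KP] (y : V) : exists K : {set V}, y \in Y ->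
    (#|K| <= d)%N /\ forall x, (forall l, l \in K -> dot l x = 0) ->
       (N ^ 3 <= b * #|reps (fib y) x|)%N.
  have [|nY] := boolP (y \in Y); last by exists set0.
  by rewrite inE => /(Bogolyubov p_prime)[K K1 K2]; exists K; rewrite dE bE.
(* Rows beyond the size of K y are filled with zeros. *)
pose frame y := \matrix_(i < d) nth 0 (enum (K y)) i.
have fibre x y : y \in Y -> frame y *m x^T = 0 -> (x, y) \in phiH P.
  move=> yY Fx; have [Kd Krep] := KP y yY.
  have /Krep big : forall l, l \in K y -> dot l x = 0.
    move=> l lK; have il : (index l (enum (K y)) < d)%N.
      by apply: leq_trans Kd; rewrite cardE index_mem mem_enum.
    have lE : l = row (Ordinal il) (frame y) by rewrite rowK nth_index // mem_enum.
    by rewrite /dot lE -row_mul Fx mxE mxE.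
  have /set0Pn[q] : reps (fib y) x != set0.
    by apply: contraTneq big => ->; rewrite cards0 muln0 -ltnNge expn_gt0 N0.
  move=> qr; apply/phiHP; move: qr.
  rewrite inE => /and4P[]; rewrite !in_set => h1 h2 h3 h4.
  exists q.1.1, q.1.2, q.2, (q.1.1 + q.1.2 - q.2 - x); split => //.
  by rewrite opprB addrC subrK.
have column x y q : q \in reps Y y -> reps_span frame y q *m x^T = 0 -> (x, y) \in phiV (phiH P).
  rewrite inE => /and4P[Y1 Y2 Y3 Y4] Ux; apply/phiVP.
  have sub m (A : 'M[F]_(m, n)) : (A <= reps_span frame y q)%MS -> A *m x^T = 0.
    by case/submxP => u ->; rewrite -mulmxA Ux mulmx0.
  exists q.1.1, q.1.2, q.2, (q.1.1 + q.1.2 - q.2 - y).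
  have in_fibre z : z \in Y -> (frame z <= reps_span frame y q)%MS -> (x, z) \in phiH P.
    by move=> zY /sub; apply: fibre.
  split; [apply: in_fibre Y1 _ | apply: in_fibre Y2 _ | apply: in_fibre Y3 _ |
          apply: in_fibre Y4 _ | by rewrite opprB addrC subrK]; rewrite /reps_span.
  - by rewrite -!addsmxA addsmxSl.
  - by rewrite -addsmxA (submx_trans _ (addsmxSl _ _)) ?addsmxSr.
  - by rewrite (submx_trans _ (addsmxSl _ _)) ?addsmxSr.
  - exact: addsmxSr.
have [M0 [T0 [exh0 rM0 dT0]]] := exhaustion p_prime frame Y gE LE ZE.
have [M [Phi [sub reg rM dT]]] := regularize t M0 T0.
have exh : exhausted frame Y k M Phi := exhausted_mono sub exh0.
rewrite -rE in rM0 dT0.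
exists M, Phi, S; split => //.
- by apply: leq_trans rM _; rewrite leq_add // leq_mul2r dT0 orbT.
- exact: leq_trans dT dT0.
move=> x y Mx /Srep many Tx.
have [q [q' [qr q'r capq]]] :=
  generic_pair p_prime reg exh many k0 kl (leq_trans dT dT0) tl.
have [|x1 [x2 [-> U1 U2]]] := @annihilator_cap _ _ (reps_span frame y q) (reps_span frame y q') x.
  move=> w wq wq'; have /exists_inP[C CT /submxP[u wE]] := capq w wq wq'.
  have -> : w = y *m C + u *m M by rewrite -wE addrC subrK.
  rewrite mulmxDl -[u *m M *m _]mulmxA Mx mulmx0 addr0.
  by apply/matrixP => i j; rewrite !ord1 [RHS]mxE; apply: Tx.
apply/phiHP; exists x1, x2, 0, 0; rewrite !subr0.
by split=> //; [apply: column qr _|apply: column q'r _|apply: column qr _|apply: column qr _];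
  rewrite ?trmx0 ?mulmx0.
Qed.
End Core.

Import passmx.

(** * Passage to abstract spaces *)

Section Transfer.
Variables (U W : finZmodType) (h : U -> W).
Hypotheses (hD : {morph h : x y / x + y}) (hB : {morph h : x y / x - y}).
Variables (P : {set U * U}) (Q : {set W * W}).
Hypothesis PQ : forall x y, (x, y) \in P -> (h x, h y) \in Q.

(** Stated for a map between two groups so that it can be iterated along
    phiH (phiV (phiH _)). *)
Lemma phiH_morph x y : (x, y) \in phiH P -> (h x, h y) \in phiH Q.
Proof.
move=> /phiHP[x1 [x2 [x3 [x4 [P1 P2 P3 P4 ->]]]]]; apply/phiHP.
by exists (h x1), (h x2), (h x3), (h x4); split; rewrite ?PQ // !hB hD.
Qed.

Lemma phiV_morph x y : (x, y) \in phiV P -> (h x, h y) \in phiV Q.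
Proof.
move=> /phiVP[x1 [x2 [x3 [x4 [P1 P2 P3 P4 ->]]]]]; apply/phiVP.
by exists (h x1), (h x2), (h x3), (h x4); split; rewrite ?PQ // !hB hD.
Qed.
End Transfer.

Section Bilinear.
Variables (F : fieldType) (V : vectType F) (W1 W2 : {vspace V}).
Let n := \dim {:V}.
Variable C : 'M[F]_n.

Definition mxform (x : subvs_of W1) (y : subvs_of W2) : F :=
  (rVof (vbasis {:V}) (vsval y) *m C *m (rVof (vbasis {:V}) (vsval x))^T) 0 0.

Lemma mxform_bilinear : bilinear_for
  (GRing.Scale.Law.clone _ _ *%R _) (GRing.Scale.Law.clone _ _ *%R _) mxform.
Proof.
split=> [u'|u] a x y; rewrite /mxform !linearP /=.
  by rewrite [LHS]mxE [X in X + _]mxE.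
by rewrite !mulmxDl -!scalemxAl [LHS]mxE [X in X + _]mxE.
Qed.

HB.instance Definition _ := bilinear_isBilinear.Build F _ _ _ _ _ mxform mxform_bilinear.

Definition mxform_form : bilinear_form W1 W2 := mxform.
End Bilinear.

Lemma codim_kernel (F : fieldType) (V : vectType F) m (B : 'M[F]_(m, \dim {:V})) :
  exists2 W : {vspace V}, (codimv W <= m)%N &
    forall v, v \in W -> B *m (rVof (vbasis {:V}) v)^T = 0.
Proof.
pose f : 'Hom(V, 'rV[F]_m) := linfun (mulmxr B^T \o rVof (vbasis {:V})).
exists (lker f).
  rewrite /codimv leq_subLR -{1}(limg_ker_dim f {:V}) capfv leq_add2l.
  by apply: leq_trans (dimvS (subvf _)) _; rewrite dimvf dim_matrix mul1r.
move=> v; rewrite memv_ker lfunE /= => /eqP e.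
by apply: trmx_inj; rewrite trmx_mul trmxK e trmx0.
Qed.

Lemma affine_le_16mul d r : (d < r -> 1 < r -> (6 * d + 4 * r + 2).+1 <= 2 ^ 4 * r)%N.
Proof. lia. Qed.

(** All quantities are estimated by powers of Q = p^(14 d): the energy threshold
    k is Q, the exponent in Freiman's theorem is at most E = Q^190, the number r of
    exhaustion steps is at most p^(2 E), and r + r t is at most 16 r^2. *)
Lemma admissible_parameters p : (1 < p)%N -> exists c, forall D, (0 < D)%N ->
  exists k t g L Z r, let d := (2 * (2 * D) ^ 2)%N in let b := (2 * (2 * D) ^ 4)%N in
   [/\ [/\ g = (4 * k ^ 4)%N, L = (64 * g ^ 9)%N,
     Z = (4 * g ^ 2 * (p ^ (2 * g * L ^ 4) * L ^ 2))%N & r = (Z * p ^ d)%N],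
     (0 < k)%N, (8 * p ^ (8 * d) * b <= k)%N, (4 * p ^ (4 * d + 4 * r) * b <= p ^ t)%N &
     [/\ r + r * t <= p ^ (p ^ (c * D ^ 2)), r <= p ^ (p ^ (c * D ^ 2)) &
         d <= p ^ (p ^ (c * D ^ 2))]%N].
Proof.
move=> p1; exists (8 * 14 * 191)%N => D D0; cbv zeta.
have p0 : (0 < p)%N by apply: ltnW.
set d := (2 * (2 * D) ^ 2)%N; set b := (2 * (2 * D) ^ 4)%N.
have dE : d = (8 * D ^ 2)%N by rewrite /d expnMn mulnA.
have d0 : (0 < d)%N by rewrite dE muln_gt0 expn_gt0 D0.
pose Q := (p ^ (14 * d))%N.
have lin m : (m <= p ^ m)%N by apply/ltnW/ltn_expl.
have const m e : (m <= e)%N -> (2 ^ m <= p ^ e)%N.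
  move=> me; apply: (@leq_trans (p ^ m)); last by rewrite leq_exp2l.
  by case: m me => // m _; rewrite leq_exp2r.
have Q64 : (2 ^ 6 <= Q)%N by apply: const; lia.
have bd : (b <= p ^ (2 * d))%N.
  apply: (@leq_trans (d ^ 2)); last by rewrite mulnC expnM leq_exp2r.
  rewrite /b /d (expnM _ 2 2) -!mulnn; nia.
clearbody d b.
have Q0 : (0 < Q)%N by rewrite expn_gt0 p0.
have [k kE] : exists k, k = Q by exists Q.
have [g gE] : exists g, g = (4 * k ^ 4)%N by exists (4 * k ^ 4)%N.
have [L LE] : exists L, L = (64 * g ^ 9)%N by exists (64 * g ^ 9)%N.
have [Z ZE] : exists Z, Z = (4 * g ^ 2 * (p ^ (2 * g * L ^ 4) * L ^ 2))%N.
  by exists (4 * g ^ 2 * (p ^ (2 * g * L ^ 4) * L ^ 2))%N.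
have [r rE] : exists r, r = (Z * p ^ d)%N by exists (Z * p ^ d)%N.
have [t tE] : exists t, t = (6 * d + 4 * r + 2)%N by exists (6 * d + 4 * r + 2)%N.
exists k, t, g, L, Z, r; split => //; first by rewrite kE.
- apply: (@leq_trans (p ^ (3 * d) * p ^ (8 * d) * p ^ (2 * d))).
    apply: (leq_mul _ bd); apply: (leq_mul _ (leqnn _)); apply: (const 3).
    by rewrite -{1}[3]muln1 leq_mul2l d0.
  by rewrite -!expnD kE leq_exp2l //; move: (d) => e; lia.
- apply: (@leq_trans (p ^ 2 * p ^ (4 * d + 4 * r) * p ^ (2 * d))).
    by apply: (leq_mul _ bd); apply: (leq_mul _ (leqnn _)); apply: (const 2).
  by rewrite -!expnD leq_exp2l // tE; move: (d) (r) => e s; lia.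
(* An opaque power function keeps the numerical exponents from being unfolded. *)
have [pw pwE] : exists pw, forall e, pw e = (Q ^ e)%N by exists (expn Q).
have pwD a c : (pw (a + c) = pw a * pw c)%N by rewrite !pwE expnD.
have pwM a c : (pw a ^ c = pw (a * c))%N by rewrite !pwE expnM.
have pw_le a c : (a <= c)%N -> (pw a <= pw c)%N by rewrite !pwE; apply: leq_pexp2l.
have pw1 : pw 1%N = Q by rewrite pwE expn1.
have c64 : (64 <= pw 1)%N by rewrite pw1; apply: Q64.
have c4 : (4 <= pw 1)%N by apply: leq_trans c64.
have c2 : (2 <= pw 1)%N by apply: leq_trans c64.
have gQ : (g <= pw 5)%N.
  by rewrite gE kE -pw1 pwM (pwD 1 4)%N; apply: leq_mul.
have LQ : (L <= pw 46)%N.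
  rewrite LE (pwD 1 45)%N; apply: leq_mul => //.
  by rewrite -[X in (_ <= pw X)%N]/(5 * 9)%N -pwM leq_exp2r.
have eQ : (2 * g * L ^ 4 <= pw 190)%N.
  rewrite (pwD 6 184)%N; apply: leq_mul.
    by rewrite (pwD 1 5)%N; apply: leq_mul.
  by rewrite -[X in (_ <= pw X)%N]/(46 * 4)%N -pwM leq_exp2r.
have [E EE] : exists E, E = pw 190 by exists (pw 190).
rewrite -EE in eQ.
have rQ : (r <= p ^ (2 * E))%N.
  apply: (@leq_trans (pw 104 * p ^ E)).
    have g2 : (g ^ 2 <= pw 10)%N.
      by rewrite -[X in (_ <= pw X)%N]/(5 * 2)%N -pwM leq_exp2r.
    have L2 : (L ^ 2 <= pw 92)%N.
      by rewrite -[X in (_ <= pw X)%N]/(46 * 2)%N -pwM leq_exp2r.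
    have pd : (p ^ d <= pw 1)%N by rewrite pw1 leq_exp2l // leq_pmull.
    have pE : (p ^ (2 * g * L ^ 4) <= p ^ E)%N by rewrite leq_exp2l.
    have := leq_mul (leq_mul (leq_mul c4 g2) (leq_mul pE L2)) pd.
    rewrite -ZE -rE => /leq_trans; apply.
    rewrite (pwD 11 93)%N (pwD 1 10)%N (pwD 92 1)%N.
    by rewrite -!mulnA leq_mul // leq_mul // mulnC -mulnA.
  rewrite mul2n -addnn expnD leq_mul2r; apply/orP; right.
  rewrite pwE -expnM leq_exp2l // EE.
  apply: (@leq_trans (pw 1 * (pw 1 * pw 1))).
    apply: leq_mul; first by rewrite pw1; apply: lin.
    by apply: (@leq_trans (64 * 64)) => //; apply: leq_mul.
  by rewrite -!pwD pw_le.
have E1 : (1 <= E)%N by rewrite EE pwE expn_gt0 Q0.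
have [T TE] : exists T, T = (8 * 14 * 191 * D ^ 2)%N by exists (8 * 14 * 191 * D ^ 2)%N.
rewrite -TE.
have Efin : (8 * E <= p ^ T)%N.
  have -> : T = (14 * d * 191)%N.
    rewrite TE dE; move: (D ^ 2)%N => u.
    by rewrite -!mulnA mulnCA [(u * _)%N]mulnC.
  rewrite expnM -/Q -pwE (pwD 1 190)%N EE; apply: leq_mul => //.
  by apply: leq_trans c64.
clear TE.
have fin m : (m <= p ^ (4 + 4 * E))%N -> (m <= p ^ (p ^ T))%N.
  move=> h; apply: leq_trans h _; rewrite leq_exp2l //; apply: leq_trans Efin.
  by rewrite -[8%N]/(4 + 4)%N mulnDl leq_add2r leq_pmulr.
have r_ge : (p ^ d <= r)%N.
  have g0 : (0 < g)%N by rewrite gE muln_gt0 expn_gt0 kE Q0.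
  have L0 : (0 < L)%N by rewrite LE muln_gt0 expn_gt0 g0.
  by rewrite rE leq_pmull // ZE !muln_gt0 !expn_gt0 p0 g0 L0.
have dr : (d < r)%N by apply: leq_trans r_ge; apply: ltn_expl.
have r2 : (2 <= r)%N := leq_ltn_trans d0 dr.
have rr : (r ^ 2 <= p ^ (4 * E))%N.
  by rewrite -[4%N]/(2 * 2)%N -mulnA mulnC expnM leq_exp2r.
have all : (r + r * t <= p ^ (4 + 4 * E))%N.
  rewrite expnD; apply: (@leq_trans (2 ^ 4 * r ^ 2)).
    rewrite -mulnS -mulnn mulnCA leq_mul // tE.
    exact: affine_le_16mul.
  by rewrite leq_mul // const.
split; apply: fin => //.
  by apply: leq_trans (leq_addr _ _) all.
by apply: leq_trans (ltnW dr) _; apply: leq_trans (leq_addr _ _) all.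
Qed.

(** * The bound and the theorem *)

(** Coordinates in a basis of V transport the statement to row vectors; the
    operations phiH and phiV commute with the coordinate isomorphism. *)
Lemma bilinear_Bogolyubov (p : nat) (p_prime : prime p) : exists c : nat, forall D : nat, (0 < D)%N ->
  forall (V : vectType 'F_p) (P : {set finvect_type V * finvect_type V}),
    (#|finvect_type V| ^ 2 <= D * #|P|)%N ->
    exists (W1 W2 : {vspace V}) (r3 : nat) (Q : 'I_r3 -> bilinear_form W1 W2),
      (forall (x : subvs_of W1) (y : subvs_of W2), (forall i, Q i x y = 0) ->
         (vsval x, vsval y) \in phiH (phiV (phiH P))) /\
      (maxn (codimv W1) (maxn (codimv W2) r3) <= p ^ (p ^ (c * D ^ 2)))%N.
Proof.
have [c par] := admissible_parameters (prime_gt1 p_prime); exists c => D D0 V P dense.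
have [k [t [g [L [Z [r [[gE LE ZE rE] k0 kl tl [B1 B2 B3]]]]]]]] := par D D0.
set d := (2 * (2 * D) ^ 2)%N in rE kl tl B3; set b := (2 * (2 * D) ^ 4)%N in kl tl.
pose e := vbasis {:V}; have e_basis : basis_of {:V} e := vbasisP _.
pose n := \dim {:V}.
pose h : 'rV['F_p]_n -> finvect_type V := vecof e.
pose P' : {set 'rV['F_p]_n * 'rV['F_p]_n} := [set z | (h z.1, h z.2) \in P].
have hK : cancel (rVof e) h := rVofK e_basis.
have h_bij : bijective h by exists (rVof e) => // v; exact: vecofK e_basis v.
have cardV : #|finvect_type V| = (p ^ n)%N.
  by rewrite -(bij_eq_card h_bij) card_rVp.
have cardP : #|P'| = #|P|.
  rewrite -(card_imset _ (f := fun z : 'rV['F_p]_n * 'rV['F_p]_n => (h z.1, h z.2))).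
    apply: eq_card => -[x y]; apply/imsetP/idP => [[z + ->]|xyP]; first by rewrite inE.
    by exists (rVof e x, rVof e y); rewrite ?inE /= !hK.
  by move=> [x y] [x' y'] [/(bij_inj h_bij)-> /(bij_inj h_bij)->].
have dense' : ((p ^ n) ^ 2 <= D * #|P'|)%N by rewrite cardP -cardV.
have [M [Phi [S [rM dT cS core]]]] :=
  bilinear_Bogolyubov_coord p_prime (erefl d) (erefl b) gE LE ZE rE k0 kl tl dense'.
have [W1 cW1 W1P] := codim_kernel (row_base M).
have [W2 cW2 W2P] := codim_kernel (\matrix_(i < #|S|) (enum_val i : 'rV['F_p]_n)).
pose Q (i : 'I_(\dim Phi)) : bilinear_form W1 W2 := mxform_form W1 W2 (vbasis Phi)`_i.
exists W1, W2, (\dim Phi), Q; split; last first.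
  rewrite !geq_max (leq_trans cW1) ?(leq_trans rM) //.
  by rewrite (leq_trans cW2) ?(leq_trans cS) // (leq_trans dT).
move=> x y Qxy.
have -> : vsval x = h (rVof e (vsval x)) by rewrite hK.
have -> : vsval y = h (rVof e (vsval y)) by rewrite hK.
have hD : {morph h : u v / u + v} by move=> u v; rewrite /h linearD.
have hB : {morph h : u v / u - v} by move=> u v; rewrite /h linearB.
apply: (phiH_morph hD hB (P := phiV (phiH P'))).
  apply: (phiV_morph hD hB (P := phiH P')).
  apply: (phiH_morph hD hB (P := P')).
  by move=> u v; rewrite inE.
apply: core.
- have /submxP[u ->] : (M <= row_base M)%MS by rewrite eq_row_base.
  by rewrite -mulmxA W1P ?mulmx0 // subvsP.
- move=> l lS; have := W2P (vsval y) (subvsP y).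
  set B := \matrix_(i < #|S|) _ => By.
  have lE : l = row (enum_rank_in lS l) B by rewrite rowK enum_rankK_in.
  by rewrite /dot lE -row_mul By !mxE.
move=> C CT; rewrite (coord_vbasis CT) /dot mulmx_sumr mulmx_suml summxE big1 // => i _.
rewrite -scalemxAr -scalemxAl mxE; have := Qxy i; rewrite /Q /mxform_form /= /mxform => ->.
by rewrite mulr0.
Qed.

Section Bound.
Variable R : realType.

Lemma affine_le_square (A l : R) : 0 <= A -> A + 2 <= l -> A + 2 * l <= l ^+ 2.
Proof. by move=> A0 Al; nra. Qed.

Lemma natr_exp_expR p m : (0 < p)%N -> ((p ^ m)%N%:R : R) = expR (ln p%:R * m%:R).
Proof.
by move=> p0; rewrite natrX -[in LHS](@lnK R p%:R) ?posrE ?ltr0n // mulrC expRM_natl.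
Qed.

(** Since D^2 <= 4 delta^-2 = 4 exp (2 l) with l = log delta^-1, the quantity is at
    most exp (exp (exp (A + 2 l))) for a constant A depending on p.  If
    l >= A + 2 then A + 2 l <= l^2, so the exponent 2 suffices; smaller l are
    absorbed into the constant C. *)
Lemma triple_exponential p c : (1 < p)%N -> exists C K : R, [/\ 0 < C, 0 < K &
  forall delta : R, 0 < delta <= 1 -> forall D : nat, D%:R <= delta^-1 + 1 ->
    (p ^ (p ^ (c * D ^ 2)))%N%:R <= C * expR (expR (expR (ln delta^-1 `^ K)))].
Proof.
move=> p1; have p0 : (0 < p)%N by apply: ltnW.
pose lam : R := ln p%:R.
have lam0 : 0 <= lam by rewrite ln_ge0 // ler1n.
pose A : R := lam * (1 + 4 * c%:R).
have A0 : 0 <= A by rewrite mulr_ge0 // addr_ge0 // mulr_ge0.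
have [C CE] : exists C : R, C = expR (expR (expR (A + 2 * (A + 2)))) by eexists.
exists C, 2; split; [by rewrite CE expR_gt0 | by [] |].
move=> delta /andP[d0 d1] D hD.
set l := ln delta^-1.
have di1 : 1 <= delta^-1 by rewrite invf_ge1.
have l0 : 0 <= l by rewrite ln_ge0.
have dl : delta^-1 = expR l by rewrite lnK // posrE invr_gt0.
have D2 : (D ^ 2)%N%:R <= 4 * expR (2 * l) :> R.
  have -> : expR (2 * l) = delta^-1 ^+ 2 by rewrite expRM_natl -dl.
  rewrite natrX; have D0 : 0 <= D%:R :> R by [].
  move: (delta^-1) D0 di1 hD => u; move: (D%:R : R) => v; nra.
have inner : lam + lam * (c * D ^ 2)%N%:R <= expR (A + 2 * l).
  apply: (@le_trans _ _ (A * expR (2 * l))); last first.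
    rewrite expRD ler_wpM2r ?expR_ge0 //; have := expR_ge1Dx A; lra.
  have e1 : 1 <= expR (2 * l) by rewrite -[leLHS]expR0 ler_expR mulr_ge0.
  rewrite /A -{1}[lam]mulr1 -mulrDr -mulrA ler_wpM2l //.
  rewrite natrM mulrDl mul1r lerD // mulrAC [c%:R * _]mulrC.
  by rewrite ler_wpM2r.
have mid : lam * (p ^ (c * D ^ 2))%N%:R <= expR (expR (A + 2 * l)).
  rewrite natr_exp_expR // -/lam.
  apply: (@le_trans _ _ (expR lam * expR (lam * (c * D ^ 2)%N%:R))).
    rewrite ler_wpM2r ?expR_ge0 //; have := expR_ge1Dx lam; lra.
  by rewrite -expRD ler_expR.
have outer : (p ^ (p ^ (c * D ^ 2)))%N%:R <= expR (expR (expR (A + 2 * l))).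
  by rewrite natr_exp_expR // -/lam ler_expR.
apply: le_trans outer _.
have rhs1 : 1 <= expR (expR (expR (l `^ 2))).
  by rewrite -[leLHS]expR0 ler_expR expR_ge0.
have C1 : 1 <= C by rewrite CE -[leLHS]expR0 ler_expR expR_ge0.
have [big|small] := leP (A + 2) l.
  apply: (@le_trans _ _ (expR (expR (expR (l `^ 2))))).
    by rewrite !ler_expR powR_mulrn // affine_le_square.
  exact: ler_peMl (expR_ge0 _) C1.
apply: (@le_trans _ _ C); first by rewrite CE !ler_expR lerD2l ler_pM2l // ltW.
by apply: ler_peMr rhs1; rewrite CE expR_ge0.
Qed.
End Bound.

Theorem theorem2 (R : realType) (p : nat) (p_prime : prime p) :
  exists c : R -> R,
    [/\ forall delta : R, 0 < delta -> 0 < c delta,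
        forall delta : R, 0 < delta ->
        forall (V : vectType 'F_p)
               (P : {set finvect_type V * finvect_type V}),
          #|P|%:R = delta * #|finvect_type V|%:R ^+ 2 ->
          exists (W1 W2 : {vspace V}) (r1 r2 r3 : nat)
                 (Q : 'I_r3 -> bilinear_form W1 W2),
            [/\ codimv W1 = r1,
                codimv W2 = r2,
                forall (x : subvs_of W1) (y : subvs_of W2),
                  (forall i : 'I_r3, Q i x y = 0) ->
                  (vsval x, vsval y) \in phiH (phiV (phiH P))
              & (maxn r1 (maxn r2 r3))%:R <= c delta]
      & exists C K : R, [/\ 0 < C, 0 < K &
          forall delta : R, 0 < delta <= 1 ->
            c delta <= C * expR (expR (expR (ln delta^-1 `^ K)))]].
Proof.
have [c Bog] := bilinear_Bogolyubov p_prime.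
have [C [K [C0 K0 bound]]] := triple_exponential R c (prime_gt1 p_prime).
pose D (delta : R) := (Num.truncn delta^-1).+1.
exists (fun delta => (p ^ (p ^ (c * D delta ^ 2)))%N%:R); split.
- by move=> delta _; rewrite ltr0n expn_gt0 prime_gt0.
- move=> delta d0 V P dens.
  have [|W1 [W2 [r3 [Q [QP small]]]]] := Bog (D delta) isT V P.
    rewrite -(ler_nat R) natrM dens mulrA natrX -[leLHS]mul1r ler_wpM2r ?exprn_ge0 //.
    by rewrite -ler_pdivrMr // mul1r ltW // truncnS_gt.
  exists W1, W2, (codimv W1), (codimv W2), r3, Q; split => //.
  by rewrite ler_nat.
exists C, K; split => // delta /andP[d0 d1]; apply: bound; first by rewrite d0.
rewrite -natr1 lerD2r truncn_le // invr_ge0 ltW //.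
Qed.
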